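(* For every $a\in\mathcal{K}$, the following hold. (1) The holomorphic correspondence $\mathcal{F}_a$ on $\widehat{\mathbb{C}}$ is weakly-modular, and it is not modular. (2) The set $\partial\Lambda_{a,-}$ (the boundary of the backward limit set of $\mathcal{F}_a$) is not a repeller for $\mathcal{F}_a$.
   Context: **The correspondences.** $\widehat{\mathbb{C}}$ is the Riemann sphere and $\pi_1,\pi_2$ are the coordinate projections of a product $X\times X$. A holomorphic correspondence on a compact Riemann surface $X$ is a multivalued map $F$ induced by a formal sum (its graph) $\Gamma=\sum_i n_i\Gamma(i)$, with $n_i$ non-negative integers and $\Gamma(i)\subset X\times X$ irreducible one-dimensional subvarieties, such that $\pi_1|_{\Gamma(i)},\pi_2|_{\Gamma(i)}$ are surjective whenever $n_i>0$; $w\in F(z)$ iff $(z,w)\in\Gamma(i)$ for some $i$. For a set $S$, $F(S)=\bigcup_{z\in S}F(z)$. The adjoint $F^{-1}$ has graph obtained by swapping coordinates. $d(F)=\sum_i n_i\deg(\pi_2|_{\Gamma(i)})$. Let $Q(z)=z^3-3z$. Let $\Gamma_0\subset\widehat{\mathbb{C}}\times\widehat{\mathbb{C}}$ be the closure of $\{(z,w)\in\mathbb{C}^2: \frac{Q(z)-Q(w)}{z-w}=z^2+zw+w^2-3=0\}$ (the closure adds only the point $(\infty,\infty)$), and let $\mathrm{Cov}_0^Q$ be the correspondence with graph $\Gamma_0$. For $a\in\mathbb{C}\setminus\{1\}$ let $J_a(z)=\frac{(a+1)z-2a}{2z-(a+1)}$, an involution of $\widehat{\mathbb{C}}$, and let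 $\mathcal{F}_a=J_a\circ \mathrm{Cov}_0^Q$, with graph $\Gamma_a=\{(z,J_a(w)):(z,w)\in\Gamma_0\}$. This is an irreducible correspondence, $d(\mathcal{F}_a)=d(\mathcal{F}_a^{-1})=2$, and $\mathcal{F}_a^{-1}=\mathrm{Cov}_0^Q\circ J_a$. **Klein combination locus.** A fundamental domain for a correspondence $F$ is an open set $\Delta_F$ maximal with the property $\Delta_F\cap F(\Delta_F)=\emptyset$. A Klein combination pair for $\mathcal{F}_a$ is a pair $(\Delta_{\mathrm{Cov}},\Delta_{J})$ of fundamental domains for $\mathrm{Cov}_0^Q$ and $J_a$ respectively, both simply connected domains bounded by Jordan curves, with $\Delta_{\mathrm{Cov}}\cup\Delta_{J}=\widehat{\mathbb{C}}\setminus\{1\}$. $\mathcal{K}$ is the set of $a\in\mathbb{C}\setminus\{1\}$ for which a Klein combination pair exists. **Backward limit set.** There is a unique germ at $1$ of a holomorphic function $g$ with $g(1)=1$ whose graph lies in $\Gamma_a$; $g(1+\zeta)=1+\zeta+\frac{a-7}{3(a-1)}\zeta^2+\cdots$ if $a\ne7$ and $g(1+\zeta)=1+\zeta+\frac1{27}\zeta^4+\cdots$ if $a=7$, so $1$ is a parabolic fixed point of $g$. For $a\in\mathcal{K}$ there is a Klein combination pair $(\Delta'_{\mathrm{Cov}},\Delta'_{J})$ such that $\partial\Delta'_{\mathrm{Cov}}$ and $\partial\Delta'_{J}$ are smooth at $1$ and transverse at $1$ to the line spanned by the repelling direction of $g$ at $1$ (if $a\neq7$), respectively to the real axis (if $a=7$).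 Fix such a pair; then $\Lambda_{a,-}=\bigcap_{n\ge0}\mathcal{F}_a^{-n}(\overline{\Delta'_{J}})$, which does not depend on the choice of such a pair. **Weakly-modular.** For a curve $\Gamma(i)\subset X\times X$ and $p=\pi_j|_{\Gamma(i)}$, the multiplicity $\hat\nu_p(b)$ is the number of preimages under $p$, close to $b$, of a generic point close to $p(b)$. The pull-back $p^*\mu$ of a finite Borel measure $\mu$ on $X$ is the measure on $\Gamma(i)$ with $\int\varphi\,d(p^*\mu)=\int\sum_{b\in p^{-1}(x)}\hat\nu_p(b)\varphi(b)\,d\mu(x)$ for continuous $\varphi$ (extended additively with weights $n_i$ to $\Gamma=\sum n_i\Gamma(i)$). A correspondence $F$ on $X$ with graph $\Gamma$ and $d(F)=d(F^{-1})$ is weakly-modular if there are Borel probability measures $\mu_1,\mu_2$ on $X$ with $(\pi_1|_\Gamma)^*\mu_1=(\pi_2|_\Gamma)^*\mu_2$. **Modular.** Let $G$ be a connected Lie group, $\Lambda\subset G$ a torsion-free lattice, $K\subset G$ a compact Lie subgroup, and $g\in G$ such that $g\Lambda g^{-1}\cap\Lambda$ has finite index in $\Lambda$. The irreducible modular correspondence induced by $g$ is the multivalued map $F_g$ on $X=\Lambda\backslash G/K$ whose graph $\Gamma_g$ is the projection to $X\times X$ of the image of the map $G\to G\times G$, $x\mapsto(x,gx)$. A modular correspondence is a correspondence whose graph is of the form $\sum_j n_j\Gamma_{g_j}$ with $\Gamma_{g_j}$ of this type (same $G,\Lambda,K$). **Repeller.** For a correspondence $F$ on $X$, a set $\mathcal{R}\subset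 X$ is a repeller for $F$ if there is a set $U\subset X$ with $\mathcal{R}\subset\mathrm{int}(U)$ and $\mathcal{R}=\bigcap_{K\in\mathfrak{K}(U,F^{-1})}K$, where $\mathfrak{K}(U,F^{-1})=\{K\subset X: F^{-1}(K)\subset K\text{ and }F^{-n}(U)\subset K\text{ for some }n\ge0\}$. *)

(* Defs.v *)
From HB Require Import structures.
From mathcomp Require Import all_boot all_order all_algebra generic_quotient.
From mathcomp Require Import complex.
From mathcomp Require Import all_classical all_reals all_analysis.

Set Implicit Arguments.
Unset Strict Implicit.
Unset Printing Implicit Defensive.

Import Order.TTheory GRing.Theory Num.Theory.
Import numFieldNormedType.Exports.

Local Open Scope classical_set_scope.
Local Open Scope ring_scope.
Local Open Scope card_scope.

HB.saturate prod.

Definition boundary (T : topologicalType) (A : set T) : set T :=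
  closure A `\` A°.

Definition borel (T : ptopologicalType) := g_sigma_algebraType (@open T).

(** The formal sum [\sum_i n_i Gamma(i)] is the list of the pairs
    [(n_i, Gamma(i))]; two lists denote the same formal sum iff they give the
    same [multiplicity] to every curve. *)
Definition formal_sum (X : Type) := seq (nat * set (X * X)).

Section Correspondences.
Variable X : topologicalType.
Implicit Types (F : formal_sum X) (S U K : set X).

Definition multiplicity F (C : set (X * X)) : nat :=
  (\sum_(p <- F | `[< p.2 = C >]) p.1)%N.

Definition single_graph (C : set (X * X)) : formal_sum X := [:: (1%N, C)].

Definition adjoint F : formal_sum X :=
  [seq (p.1, [set b | p.2 (b.2, b.1)]) | p <- F].

Definition image_by F S : set X :=
  [set w | exists2 z, S z &
     exists2 p, p \in F & (0 < p.1)%N /\ p.2 (z, w)].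

Definition preimage_by F S : set X := image_by (adjoint F) S.

(** The number of points of a generic fibre of [pr] restricted to [C]; generic
    means up to finitely many base points. *)
Definition degree (pr : X * X -> X) (C : set (X * X)) : nat :=
  xget 0%N [set n | finite_set
    [set x | ~ (C `&` pr @^-1` [set x] #= `I_n)]].

Definition topological_degree F : nat :=
  (\sum_(p <- F) p.1 * degree snd p.2)%N.

(** The number of preimages close to [b] of a generic point [x] close to
    [pr b]: ramification points being isolated, generic means [x != pr b]. *)
Definition local_multiplicity (pr : X * X -> X) (C : set (X * X)) (b : X * X)
    : nat :=
  xget 0%N [set n | exists2 W0, nbhs b W0 &
    forall W, nbhs b W -> W `<=` W0 ->
      \forall x \near (pr b)^', C `&` W `&` pr @^-1` [set x] #= `I_n].

Definition fundamental_domain F (D : set X) : Prop :=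
  [/\ open D, D `&` image_by F D = set0 &
      forall D', open D' -> D' `&` image_by F D' = set0 ->
        D `<=` D' -> D' = D].

Definition repeller F (A : set X) : Prop :=
  exists2 U : set X, A `<=` U° &
    A = \bigcap_(K in [set K | preimage_by F K `<=` K /\
                         exists n, iter n (preimage_by F) U `<=` K]) K.

End Correspondences.

(** The measures on the graph are seen as measures on [X * X]. The inner sum is
    over a fibre of a projection of an irreducible curve onto [X], hence
    finite. *)
Definition is_pullback (R : realType) (X : ptopologicalType)
    (F : formal_sum X) (pr : X * X -> X)
    (mu : probability (borel X) R)
    (m : {measure set (borel (X * X)%type) -> \bar R}) : Prop :=
  forall phi : X * X -> R, continuous phi ->
    (\int[m]_b (phi b)%:E =
     \sum_(p <- F) (p.1%:R)%:E * \int[mu]_x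
       (\sum_(b \in p.2 `&` pr @^-1` [set x])
          (local_multiplicity pr p.2 b)%:R * phi b)%:E)%E.

Definition weakly_modular (R : realType) (X : ptopologicalType)
    (F : formal_sum X) : Prop :=
  topological_degree F = topological_degree (adjoint F) /\
  exists mu1 mu2 : probability (borel X) R,
  exists m : {measure set (borel (X * X)%type) -> \bar R},
    is_pullback F fst mu1 m /\ is_pullback F snd mu2 m.

Fixpoint C_k (R : realType) (V W : normedModType R) (k : nat) (U : set V)
    (f : V -> W) : Prop :=
  match k with
  | 0 => {in U, continuous f}
  | k'.+1 => {in U, forall x, differentiable f x} /\
             forall v, C_k k' U (fun x => 'D_v f x)
  end.

(** Meaningful for [U] open. *)
Definition smooth_on (R : realType) (V W : normedModType R) (U : set V)
  (f : V -> W) : Prop := forall k, C_k k U f.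

Definition chart (M E : Type) : Type := (set M * (M -> E))%type.

Definition is_chart (M E : topologicalType) (c : chart M E) : Prop :=
  [/\ open c.1, {in c.1 &, injective c.2}, {in c.1, continuous c.2} &
      forall A, open A -> A `<=` c.1 -> open (c.2 @` A)].

(** [h] is the expression [d \o f \o c^-1] of [f] in the charts [c] and [d]. *)
Definition smooth_in_charts (R : realType) (E E' : normedModType R)
    (M M' : Type) (c : chart M E) (d : chart M' E') (f : M -> M') : Prop :=
  exists2 h : E -> E', smooth_on (c.2 @` (c.1 `&` f @^-1` d.1)) h &
    forall x, c.1 x -> d.1 (f x) -> h (c.2 x) = d.2 (f x).

Record smooth_manifold (R : realType) (E : normedModType R)
    (M : topologicalType) (A : set (chart M E)) : Prop := SmoothManifold {
  manifold_hausdorff : hausdorff_space M ;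
  manifold_second_countable : @second_countable M ;
  manifold_charts : forall c, A c -> is_chart c ;
  manifold_cover : forall x, exists2 c, A c & c.1 x ;
  manifold_compatible : forall c d, A c -> A d -> smooth_in_charts c d id }.

Definition smooth_map (R : realType) (E E' : normedModType R)
    (M M' : topologicalType) (A : set (chart M E)) (A' : set (chart M' E'))
    (f : M -> M') : Prop :=
  continuous f /\ forall c d, A c -> A' d -> smooth_in_charts c d f.

Definition product_atlas (M E M' E' : Type) (A : set (chart M E))
    (A' : set (chart M' E')) : set (chart (M * M') (E * E')) :=
  [set e | exists2 c, A c & exists2 d, A' d &
     e = (c.1 `*` d.1, fun p => (c.2 p.1, d.2 p.2))].

(** No compatibility between the two structures is assumed here: the
    continuity of the operations is part of [lie_group]. *)
#[short(type="groupTopologyType")]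
HB.structure Definition GroupTopology :=
  {G of PointedTopological G & Group G}.

Record lie_group (R : realType) (G : groupTopologyType) (n : nat)
    (A : set (chart G 'rV[R]_n)) : Prop := LieGroup {
  lie_manifold : smooth_manifold A ;
  lie_mul : smooth_map (product_atlas A A) A (fun p : G * G => (p.1 * p.2)%g) ;
  lie_inv : smooth_map A A (fun x : G => (x^-1)%g) }.

Section Subgroups.
Variable G : groupTopologyType.
Implicit Types (H K L : set G) (x y g : G).

Definition subgroup H : Prop :=
  [/\ H 1%g, forall x y, H x -> H y -> H (x * y)%g &
      forall x, H x -> H (x^-1)%g].

(** Submanifolds are embedded; a compact subgroup carries no other Lie
    structure. *)
Definition lie_subgroup (R : realType) (n : nat) (A : set (chart G 'rV[R]_n))
    K : Prop :=
  subgroup K /\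
  exists k : nat, forall x, K x -> exists c : chart G 'rV[R]_n,
    [/\ is_chart c,
        forall d, A d -> smooth_in_charts c d id /\ smooth_in_charts d c id,
        c.1 x &
        c.2 @` (c.1 `&` K) =
        c.2 @` c.1 `&`
          [set v | forall i : 'I_n, (k <= i)%N -> v ord0 i = 0]].

(** For subgroups [L] and [K], two points are equivalent iff they have the same
    double coset; with equality of cosets as the relation, it is an
    equivalence for arbitrary sets. *)
Definition double_coset L K x : set G :=
  [set y | exists2 l, L l & exists2 k, K k & y = (l * x * k)%g].

Definition double_coset_rel L K : rel G :=
  fun x y => `[< double_coset L K x = double_coset L K y >].

Lemma double_coset_rel_equiv L K : equiv_class_of (double_coset_rel L K).
Proof.
split=> [x|x y|y x z]; rewrite /double_coset_rel; first exact/asboolP.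
  by apply/asboolP/asboolP.
by move=> /asboolP-> /asboolP->; apply/asboolP.
Qed.

Canonical double_coset_equiv L K :=
  EquivRelPack (double_coset_rel_equiv L K).

Definition double_coset_space L K : ptopologicalType :=
  quotient_topology {eq_quot double_coset_equiv L K}%qT.

Definition to_double_coset L K (x : G) : double_coset_space L K :=
  (\pi_({eq_quot double_coset_equiv L K}) x)%qT.

Definition right_translate L g (S : set (double_coset_space L [set 1%g])) :=
  [set to_double_coset L [set 1%g] (x * g)%g |
     x in to_double_coset L [set 1%g] @^-1` S].

(** A discrete subgroup of finite covolume: [L \ G] carries a [G]-invariant
    finite measure, here normalized. *)
Definition lattice (R : realType) L : Prop :=
  [/\ subgroup L, L `<=` isolated L &
      exists m : probability (borel (double_coset_space L [set 1%g])) R,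
        forall g (S : set (borel (double_coset_space L [set 1%g]))),
          measurable S -> m (right_translate g S) = m S].

Definition torsion_free L : Prop :=
  forall x n, L x -> (0 < n)%N -> (x ^+ n)%g = 1%g -> x = 1%g.

Definition finite_index H L : Prop :=
  finite_set [set [set y | exists2 h, H h & y = (l * h)%g] | l in L].

Definition commensurates g L : Prop :=
  finite_index ([set (g * l * g^-1)%g | l in L] `&` L) L.

Definition modular_graph L K g
    : set (double_coset_space L K * double_coset_space L K) :=
  [set (to_double_coset L K x, to_double_coset L K (g * x)%g) | x in [set: G]].

End Subgroups.

Arguments modular_graph {G} L K g.

Definition homeomorphism (X Y : topologicalType) (f : X -> Y) : Prop :=
  continuous f /\
  exists f' : Y -> X, [/\ continuous f', cancel f f' & cancel f' f].

(** [f] identifies the Riemann surface [X] with [L \ G / K]. No complex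
    structure on [L \ G / K] is singled out, so that [f] is only required to be
    a homeomorphism: the complex structure may be transported by it. *)
Definition modular (R : realType) (X : topologicalType) (F : formal_sum X)
    : Prop :=
  exists (G : groupTopologyType) (n : nat) (A : set (chart G 'rV[R]_n))
         (L K : set G) (f : double_coset_space L K -> X)
         (s : seq (nat * G)),
  [/\ lie_group A /\ connected [set: G],
      lattice R L /\ torsion_free L,
      compact K /\ lie_subgroup A K,
      homeomorphism f &
      (forall p, p \in s -> commensurates p.2 L) /\
      multiplicity F =1 multiplicity
        [seq (p.1, [set (f b.1, f b.2) | b in modular_graph L K p.2])
           | p <- s]].

Definition Cplx (R : realType) : numClosedFieldType := R[i].

Definition sphere (R : realType) : ptopologicalType :=
  one_point_compactification (Cplx R).

Section MatingFamily.
Variable R : realType.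
Local Notation C := (Cplx R).
Local Notation Chat := (sphere R).

Definition fin (z : C) : Chat := Some z.
Definition infty : Chat := None.

(** With [Q(z) = z^3 - 3 z], one has
    [(Q(z) - Q(w)) / (z - w) = z^2 + z w + w^2 - 3]. *)
Definition graph_cov : set (Chat * Chat) :=
  closure [set (fin p.1, fin p.2) | p in
    [set p : C * C | p.1 ^+ 2 + p.1 * p.2 + p.2 ^+ 2 - 3 = 0]].

Definition Jinv (a : C) (z : Chat) : Chat :=
  match z with
  | Some z => if 2 * z - (a + 1) == 0 then infty
              else fin (((a + 1) * z - 2 * a) / (2 * z - (a + 1)))
  | None => fin ((a + 1) / 2)
  end.

Definition graph_F (a : C) : set (Chat * Chat) :=
  [set (p.1, Jinv a p.2) | p in graph_cov].

Definition Cov : formal_sum Chat := single_graph graph_cov.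
Definition Jcorr (a : C) : formal_sum Chat :=
  single_graph [set p | p.2 = Jinv a p.1].
Definition F_corr (a : C) : formal_sum Chat := single_graph (graph_F a).

Definition simply_connected (T : topologicalType) (D : set T) : Prop :=
  forall c : R -> T,
    {within `[0, 1], continuous c} -> c @` `[0, 1] `<=` D -> c 0 = c 1 ->
  exists H : R * R -> T,
    [/\ {within `[0, 1] `*` `[0, 1], continuous H},
        H @` (`[0, 1] `*` `[0, 1]) `<=` D,
        {in `[0, 1], forall t, H (0, t) = c t /\ H (1, t) = c 0} &
        {in `[0, 1], forall s, H (s, 0) = c 0 /\ H (s, 1) = c 0}].

Definition jordan_curve (T : topologicalType) (S : set T) : Prop :=
  exists c : R -> T,
    [/\ {within `[0, 1], continuous c}, c 0 = c 1,
        {in `[0, 1[ &, injective c} & S = c @` `[0, 1]].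

Definition jordan_domain (T : topologicalType) (D : set T) : Prop :=
  [/\ open D, D !=set0, connected D, simply_connected D &
      jordan_curve (boundary D)].

Definition klein_pair (a : C) (Dcov DJ : set Chat) : Prop :=
  [/\ fundamental_domain Cov Dcov, fundamental_domain (Jcorr a) DJ,
      jordan_domain Dcov, jordan_domain DJ &
      Dcov `|` DJ = [set: Chat] `\ fin 1].

Definition klein_locus : set C :=
  [set a | a != 1 /\ exists Dcov DJ, klein_pair a Dcov DJ].

Definition parabolic_branch (a : C) (g : C -> C) : Prop :=
  g 1 = 1 /\
  \forall z \near (1 : C), derivable g z 1 /\ graph_F a (fin z, fin (g z)).

(** For [g(1 + u) = 1 + u + c u^2 + ...] with [c != 0], the repelling direction
    at [1] is that of the [u] for which [c u] is a positive real; here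
    [c = g''(1) / 2]. In the order of [C], [0 < x] entails that [x] is real. *)
Definition repelling_direction (g : C -> C) (u : C) : Prop :=
  0 < derive1n 2 g 1 * u.

(** [u] spans the line to which the boundaries must be transverse at [1]. *)
Definition axis_direction (a u : C) : Prop :=
  if a == 7 then u = 1
  else exists2 g, parabolic_branch a g & repelling_direction g u.

(** Near [1], [S] is an embedded smooth arc with nonzero tangent vector [v]
    at [1]. *)
Definition smooth_at_one (S : set Chat) (v : C) : Prop :=
  exists (W : set Chat) (e : R) (x y : R -> R),
    let c t : C := (x t +i* y t)%C in
    [/\ nbhs (fin 1) W /\ 0 < e,
        smooth_on `]-e, e[ x /\ smooth_on `]-e, e[ y,
        {in `]-e, e[ &, injective c} /\ c 0 = 1,
        v = (derive1 x 0 +i* derive1 y 0)%C /\ v != 0 &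
        S `&` W = (fin \o c) @` `]-e, e[ `&` W].

Definition smooth_transverse_at_one (S : set Chat) (u : C) : Prop :=
  exists2 v, smooth_at_one S v & 'Im (v / u) != 0.

Definition adapted_klein_pair (a : C) (Dcov DJ : set Chat) : Prop :=
  klein_pair a Dcov DJ /\
  exists u, [/\ axis_direction a u,
    smooth_transverse_at_one (boundary Dcov) u &
    smooth_transverse_at_one (boundary DJ) u].

Definition backward_limit_set (a : C) (DJ : set Chat) : set Chat :=
  \bigcap_n iter n (preimage_by (F_corr a)) (closure DJ).

End MatingFamily.

(* Main.v *)
Require Import Defs.
From mathcomp Require Import all_boot all_order all_algebra.
From mathcomp Require Import all_classical all_reals all_analysis.
From mathcomp Require Import complex generic_quotient ring lra.

Set Implicit Arguments.
Unset Strict Implicit.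
Unset Printing Implicit Defensive.

Import Order.TTheory GRing.Theory Num.Theory.
Import numFieldNormedType.Exports.

Local Open Scope classical_set_scope.
Local Open Scope ring_scope.

(** (1) The graph has a single point above [infty] for the first projection and
    a single point above [J_a(infty)] for the second one, both equal to
    [(infty, J_a(infty))]. The symmetry [(z, v) |-> (J_a v, J_a z)] of the graph
    fixes this point and exchanges the two projections, so the Dirac masses at
    [infty] and [J_a(infty)] have the same pull-back. A modular correspondence
    on [L \ G / K], with [L] discrete and torsion-free and [K] compact, has a
    continuous selection near every point, whereas [F_a] has none near the
    branch point [2] of [Cov_0^Q].

    (2) The boundary of the backward limit set is closed with empty interior and
    contains the parabolic point [1], so a neighbourhood [U] of it contains an
    attracting petal [P] of [g]. As [P] is contained in [F_a^{-1}(P)], it lies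
    in every set of the family that defines the repeller. *)

(** * Modulus and topology of the complex plane *)

Section ComplexPlane.
Variable R : realType.
Local Notation C := (Cplx R).
Implicit Types z w : C.

(** The norm of [C] takes its values in [C] itself; [nm] is the modulus as an element of [R], where
    real arithmetic is decided by [lra] and [nra]. *)
Definition nm (z : C) : R := complex.Re `|z|.

Lemma nmE z : `|z| = (nm z)%:C%C :> C.
Proof. by rewrite /nm normc_def. Qed.

Lemma nm_sqr z : nm z ^+ 2 = complex.Re z ^+ 2 + complex.Im z ^+ 2.
Proof. by rewrite /nm normc_def /= sqr_sqrtr// addr_ge0// sqr_ge0. Qed.

Lemma nm_ge0 z : 0 <= nm z.
Proof. by rewrite /nm normc_def /= sqrtr_ge0. Qed.

Lemma nmM z w : nm (z * w) = nm z * nm w.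
Proof. by apply: complexI; rewrite rmorphM /= -!nmE normrM. Qed.

Lemma nmV z : nm z^-1 = (nm z)^-1.
Proof. by apply: complexI; rewrite fmorphV /= -!nmE normfV. Qed.

Lemma nmX z n : nm (z ^+ n) = nm z ^+ n.
Proof. by apply: complexI; rewrite rmorphXn /= -!nmE normrX. Qed.

Lemma nmN z : nm (- z) = nm z.
Proof. by rewrite /nm normrN. Qed.

Lemma nmB z w : nm (z - w) = nm (w - z).
Proof. by rewrite /nm distrC. Qed.

Lemma ler_nmD z w : nm (z + w) <= nm z + nm w.
Proof. by rewrite -lecR rmorphD /= -!nmE ler_normD. Qed.

Lemma nm_nat n : nm n%:R = n%:R.
Proof. by apply: complexI; rewrite -nmE normr_nat rmorph_nat. Qed.

Lemma nm0 : nm 0 = 0.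
Proof. by rewrite /nm normr0. Qed.

Lemma nm_eq0 z : (nm z == 0) = (z == 0).
Proof.
apply/eqP/eqP => [nz|->]; last exact: nm0.
by apply/eqP; rewrite -normr_eq0 nmE nz.
Qed.

Lemma nm_gt0 z : (0 < nm z) = (z != 0).
Proof. by rewrite lt_neqAle nm_ge0 andbT eq_sym nm_eq0. Qed.

Lemma ler_Re_nm z : `|complex.Re z| <= nm z.
Proof.
by rewrite -(ler_pXn2r (n := 2)) ?nnegrE ?nm_ge0// real_normK ?num_real//
  nm_sqr lerDl sqr_ge0.
Qed.

Lemma ler_Im_nm z : `|complex.Im z| <= nm z.
Proof.
by rewrite -(ler_pXn2r (n := 2)) ?nnegrE ?nm_ge0// real_normK ?num_real//
  nm_sqr lerDr sqr_ge0.
Qed.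

Lemma ler_nm_ReIm z : nm z <= `|complex.Re z| + `|complex.Im z|.
Proof.
rewrite -(ler_pXn2r (n := 2)) ?nnegrE ?nm_ge0 ?addr_ge0//.
rewrite nm_sqr sqrrD !real_normK ?num_real// addrAC lerDl.
by rewrite mulrn_wge0// mulr_ge0.
Qed.

Lemma nbhsCP (z : C) (A : set C) :
  nbhs z A <-> exists2 e : R, 0 < e & forall w, nm (w - z) < e -> A w.
Proof.
split.
  move=> /nbhs_ballP[e /= e0 zA].
  have eR : e \is Num.real by rewrite realE (ltW e0).
  exists (complex.Re e); first by rewrite -ltcR (RRe_real eR).
  move=> w wz; apply: zA; rewrite /ball /= distrC nmE -(RRe_real eR).
  by rewrite ltcR.
move=> [e e0 zA]; apply/nbhs_ballP; exists (e%:C)%C; first by rewrite /= ltcR.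
by move=> w; rewrite /ball /= distrC nmE ltcR; apply: zA.
Qed.

Lemma complexRI_continuous :
  continuous (fun p : R * R => (p.1 +i* p.2)%C : C).
Proof.
move=> [x y] A /nbhsCP[e e0 zA].
have e20 : 0 < e / 2 by rewrite divr_gt0.
exists (ball x (e / 2), ball y (e / 2)) => /=; first by split;
  exact: nbhsx_ballx.
move=> [x' y'] /= [xx yy]; apply: zA;
  apply: le_lt_trans (ler_nm_ReIm _) _ => /=.
by move: xx yy; rewrite /ball /= (distrC x) (distrC y); lra.
Qed.

Lemma Re_continuous : continuous (@complex.Re R : C -> R).
Proof.
move=> z A /nbhs_ballP[e /= e0 zA]; apply/nbhsCP; exists e => // w wz.
apply: zA; rewrite /ball /= distrC.
apply: le_lt_trans wz; apply: le_trans (ler_Re_nm _).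
by move: z w => [? ?] [? ?] /=.
Qed.

Lemma hausdorffC : hausdorff_space C.
Proof. exact: norm_hausdorff. Qed.

(** A square, unlike a disc, is directly the image of a product of two compact segments. Its
    complement will serve as a neighbourhood of [infty]. *)
Lemma square_compact (M : R) : compact
  [set z : C | `|complex.Re z| <= M /\ `|complex.Im z| <= M].
Proof.
have -> : [set z : C | `|complex.Re z| <= M /\ `|complex.Im z| <= M] =
  (fun p : R * R => (p.1 +i* p.2)%C : C) @` (`[- M, M] `*` `[- M, M]).
  apply/seteqP; split.
    by move=> [x y] /= [hx hy]; exists (x, y) => //=;
      rewrite !in_itv /= -!ler_norml.
  by move=> _ [[x y] /= [hx hy] <-] /=; move: hx hy;
    rewrite !in_itv /= -!ler_norml.
apply: continuous_compact.
  by apply: continuous_subspaceT; exact: complexRI_continuous.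
by apply: compact_setX; exact: segment_compact.
Qed.

Lemma compact_nm_bounded (K : set C) : compact K ->
  exists M : R, forall z, K z -> nm z <= M.
Proof.
move=> /compact_near_coveringP cK.
(* Compactness turns the local bounds [nm z < n], for [n] tending to infinity, into one bound on
   [K]. *)
have /= := cK nat \oo (fun n z => nm z < n%:R) _ _.
case.
  move=> z Kz.
  have [n zn] : exists n : nat, nm z + 1 < n%:R.
    by exists (Num.truncn (nm z + 1)).+1; rewrite truncnS_gt.
  exists ([set w | nm (w - z) < 1], [set m | (n <= m)%N]) => /=.
    by split; [apply/nbhsCP; exists 1|exists n].
  move=> [w m] /= [wz nm_]; have := ler_nmD z (w - z); rewrite (addrC z) subrK.
  have : (n%:R : R) <= m%:R by rewrite ler_nat.
  lra.
by move=> N _ /(_ N (leqnn N)) h; exists N%:R => z Kz; exact/ltW/h.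
Qed.

Section Continuity.
Variable T : topologicalType.
Implicit Types f g : T -> C.

Lemma contM f g x : {for x, continuous f} -> {for x, continuous g} ->
  {for x, continuous (fun y => f y * g y)}.
Proof. exact: (@continuousM C T f g). Qed.

Lemma contD f g x : {for x, continuous f} -> {for x, continuous g} ->
  {for x, continuous (fun y => f y + g y)}.
Proof. exact: (@continuousD C C T f g). Qed.

Lemma contN f x : {for x, continuous f} -> {for x, continuous (fun y => - f y)}.
Proof. exact: (@continuousN C C T f). Qed.

Lemma contB f g x : {for x, continuous f} -> {for x, continuous g} ->
  {for x, continuous (fun y => f y - g y)}.
Proof. by move=> cf cg; exact: (contD cf (contN cg)). Qed.

Lemma contV f x : f x != 0 -> {for x, continuous f} ->
  {for x, continuous (fun y => (f y)^-1)}.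
Proof. exact: (@continuousV C T f). Qed.

Lemma cont_cst c (x : T) : {for x, continuous (fun _ : T => c : C)}.
Proof. exact: cvg_cst. Qed.

Lemma contX f n x : {for x, continuous f} ->
  {for x, continuous (fun y => f y ^+ n)}.
Proof.
move=> cf; elim: n => [|n IH].
  exact: (@cont_cst 1).
have -> : (fun y => f y ^+ n.+1) = (fun y => f y * f y ^+ n).
  by apply/funext => y; rewrite exprS.
exact: (contM cf IH).
Qed.

End Continuity.

Lemma cont_id (x : C) : {for x, continuous (fun z : C => z)}.
Proof. exact: cvg_id. Qed.

End ComplexPlane.

Arguments cont_cst {R T} c x.
Arguments cont_id {R} x.
Arguments contX {R T f} n {x}.

(** * Topology of the Riemann sphere and the involution [Jinv a] *)

Section Sphere.
Variable R : realType.
Local Notation C := (Cplx R).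
Local Notation Chat := (sphere R).

Lemma nbhs_finE (z : C) (A : set Chat) :
  nbhs (fin z) A = nbhs z (@fin R @^-1` A).
Proof. by []. Qed.

Lemma nbhs_fin_image (z : C) (A : set C) :
  nbhs z A -> nbhs (fin z : Chat) (@fin R @` A).
Proof. by apply: filterS; exact: preimage_image. Qed.

Lemma fin_continuous : continuous (@fin R : C -> Chat).
Proof. by move=> x U. Qed.

Lemma nbhs_inftyP (A : set Chat) :
  nbhs (infty R : Chat) A <->
  A (infty R) /\ exists M : R, forall z : C, M < nm z -> A (fin z).
Proof.
split.
  move=> [K [cK _] KA]; split; first by apply: KA; right.
  have [M KM] := compact_nm_bounded cK.
  exists M => z Mz; apply: KA; left; exists z => // Kz.
  by have := lt_le_trans Mz (KM _ Kz); rewrite ltxx.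
move=> [Ai [M MA]]; set Q := [set z : C | `|complex.Re z| <= M /\ `|complex.Im
  z| <= M].
have cQ : compact Q := @square_compact R M.
exists Q; first by split => //; apply: compact_closed;
  [exact: hausdorffC|exact: cQ].
move=> _ [[z /= zQ <-]|-> //]; apply: MA.
rewrite ltNge; apply/negP => zM; apply: zQ.
by split; apply: le_trans zM; [exact: ler_Re_nm|exact: ler_Im_nm].
Qed.

Lemma fin_inj : injective (@fin R).
Proof. by move=> z w []. Qed.

Lemma sphere_compact : compact [set: Chat].
Proof. exact: one_point_compactification_compact. Qed.

Lemma sphere_hausdorff : hausdorff_space Chat.
Proof.
(* Only a finite point and [infty] require new neighbourhoods: the unit disc around [z], and the
   exterior of the disc of radius [nm z + 1] about 0. *)
have sep (z : C) : exists2 A : set Chat, nbhs (fin z) A &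
    exists2 B, nbhs (infty R : Chat) B & A `&` B = set0.
  exists (@fin R @` [set w | nm (w - z) < 1]).
    by apply/nbhsCP; exists 1 => // w wz; exists w.
  exists (infty R |` (@fin R @` [set w | nm z + 1 < nm w])).
    by apply/nbhs_inftyP; split; [left|exists (nm z + 1) => w; right; exists w].
  apply/seteqP; split=> // _ [[w wz <-] [//|[v vz /fin_inj vw]]]; move: vz.
  rewrite vw /=; have := ler_nmD z (w - z); rewrite (addrC z) subrK.
  by move: wz => /=; lra.
move=> [z|] [w|] // zw.
- congr Some; apply: hausdorffC => A B zA wB.
  have [_ [[x Ax <-] [y By /fin_inj yx]]] := zw (@fin R @` A) (@fin R @` B)
    (nbhs_fin_image zA) (nbhs_fin_image wB).
  by exists x; split => //; rewrite -yx.
- have [A zA [B iB AB]] := sep z.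
  by have [x xAB] := zw _ _ zA iB; move: (xAB); rewrite AB.
- have [A zA [B iB AB]] := sep w.
  by have [x xAB] := zw _ _ iB zA; move: (xAB); rewrite setIC AB.
Qed.

Section Involution.
Variable a : C.
Hypothesis a1 : a != 1.

(** In the coordinate [t = 2 * z - (a + 1)] the map is [t |-> (a - 1)^2 / t], an involution since
    [a != 1]. *)
Lemma JinvK : involutive (Jinv a).
Proof.
have a1' : a - 1 != 0 by rewrite subr_eq0.
have two : (2 : C) != 0 by rewrite pnatr_eq0.
move=> [z|] /=; last first.
  by rewrite ifT//; by apply/eqP; field.
case: ifPn => [/eqP pz|pz] /=.
  by congr Some; apply/eqP;
    rewrite -subr_eq0 -(mulrI_eq0 _ (mulfI two)) -oppr_eq0 -pz; by apply/eqP;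
      field.
have E : 2 * (((a + 1) * z - 2 * a) / (2 * z - (a + 1))) - (a + 1) =
  (a - 1) ^+ 2 / (2 * z - (a + 1)) by field.
rewrite E ifF; last by rewrite mulf_eq0 invr_eq0 (negbTE pz) sqrf_eq0 (negbTE
  a1').
by congr Some; field; rewrite pz a1'.
Qed.

Lemma Jinv1 : Jinv a (fin 1) = fin 1.
Proof.
have a1' : 2 * 1 - (a + 1) != 0.
  have -> : 2 * 1 - (a + 1) = 1 - a by ring.
  by rewrite subr_eq0 eq_sym.
by rewrite /= (negbTE a1'); congr Some; field; rewrite -[X in X - _]mulr1.
Qed.

Lemma Jinv_fin_continuous (z : C) : 2 * z - (a + 1) != 0 ->
  {for fin z, continuous (Jinv a)}.
Proof.
move=> pz A; rewrite /= (negbTE pz) /= => zA.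
have cl (b c : C) : {for z, continuous (fun w : C => b * w - c)}.
  exact: (contB (contM (cont_cst b z) (cont_id z)) (cont_cst c z)).
have cf : {for z, continuous
    (fun w : C => ((a + 1) * w - 2 * a) / (2 * w - (a + 1)))}.
  exact: (contM (cl _ _) (@contV R C (fun w => 2 * w - (a + 1)) z pz (cl _ _))).
have [e e0 ez] := (nbhsCP _ _).1 (cf _ zA).
have p0 : 0 < nm (2 * z - (a + 1)) by rewrite nm_gt0.
(* The second bound is the distance from [z] to the pole, which is thus excluded. *)
apply/nbhsCP; exists (Num.min e (nm (2 * z - (a + 1)) / 2)).
  by rewrite lt_min e0 divr_gt0.
move=> w; rewrite lt_min => /andP[we wp].
have {}/ez := we; rewrite /= ifF//; apply/negP => /eqP w0.
have E : 2 * z - (a + 1) = 2 * (z - w) by rewrite -[LHS]subr0 -w0; ring.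
by move: wp; rewrite E nmM nm_nat nmB; have := nm_ge0 (w - z); move: p0;
  rewrite E nmM nm_nat nmB; lra.
Qed.

Lemma Jinv_continuous : continuous (Jinv a).
Proof.
have a1' : 0 < nm (a - 1) by rewrite nm_gt0 subr_eq0.
have two : (2 : C) != 0 by rewrite pnatr_eq0.
move=> [z|]; last first.
  move=> A /= /nbhsCP[e e0 zA]; apply/nbhs_inftyP; split.
    by apply: zA; rewrite subrr nm0.
  set d := nm (a - 1) in a1'.
  (* With [c = (a + 1) / 2], the image of [w] minus [c] is [(a - 1)^2 / (4 (w - c))]. Beyond this
     radius [nm (w - c) > d^2 / e], so the image is within [e / 4] of [c]. *)
  exists (nm ((a + 1) / 2) + d ^+ 2 / e) => w wM.
  have M0 : 0 < d ^+ 2 / e by rewrite divr_gt0 ?exprn_gt0.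
  have dist : d ^+ 2 / e < nm (w - (a + 1) / 2).
    by have := ler_nmD (w - (a + 1) / 2) ((a + 1) / 2); rewrite subrK; lra.
  have wp : 2 * w - (a + 1) != 0.
    apply/eqP => w0; have E : w - (a + 1) / 2 = 0.
      by apply: (mulfI two); rewrite mulr0 -w0; field.
    by move: dist; rewrite E nm0; lra.
  rewrite /= (negbTE wp); apply: zA.
  have -> : ((a + 1) * w - 2 * a) / (2 * w - (a + 1)) - (a + 1) / 2 =
    (a - 1) ^+ 2 / (4 * (w - (a + 1) / 2)).
    by field; rewrite (mulrC w).
  rewrite nmM nmV nmM nmX nm_nat -/d.
  have n0 : 0 < nm (w - (a + 1) / 2) by lra.
  rewrite ltr_pdivrMr; last by lra.
  by move: dist; rewrite ltr_pdivrMr// => dist; have := exprn_gt0 2 a1'; nra.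
have [pz|pz] := eqVneq (2 * z - (a + 1)) 0; last exact: Jinv_fin_continuous.
move=> A; rewrite /= pz eqxx => /nbhs_inftyP[Ai [M MA]].
set d := nm (a - 1) in a1'.
have M1 : 0 < `|M| + 1 by apply: ltr_wpDl.
(* Here [z] is the pole [(a + 1) / 2]. The radius makes [d^2 / (4 nm (w - z))] exceed
   [|M| + 1 + nm z], so that adding [z] leaves a modulus above [M]. *)
apply/nbhsCP; exists (Num.min 1 (d ^+ 2 / (4 * (`|M| + 1 + nm ((a + 1) / 2))))).
  by rewrite lt_min ltr01 divr_gt0 ?exprn_gt0 ?mulr_gt0//;
    have := nm_ge0 ((a + 1) / 2); lra.
move=> w; rewrite lt_min => /andP[_ wz] /=; case: ifPn => // wp.
have zE : z = (a + 1) / 2 by apply: (mulfI two);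
  rewrite -(subrK (a + 1) (2 * z)) pz; field.
apply: MA; rewrite -zE in wz.
have -> : ((a + 1) * w - 2 * a) / (2 * w - (a + 1)) = (a - 1) ^+ 2 / (4 * (w -
  z)) + z.
  by rewrite zE; field; rewrite (mulrC w).
have w0 : 0 < nm (w - z).
  rewrite nm_gt0; apply: contra wp => /eqP wz0.
  have -> : 2 * w - (a + 1) = 2 * (w - z) by rewrite zE; field.
  by rewrite wz0 mulr0.
have : `|M| + 1 + nm z < nm ((a - 1) ^+ 2 / (4 * (w - z))).
  rewrite nmM nmV nmM nmX nm_nat -/d ltr_pdivlMr; last by lra.
  by move: wz; rewrite ltr_pdivlMr; have := nm_ge0 z; lra.
have := ler_nmD ((a - 1) ^+ 2 / (4 * (w - z)) + z) (- z); rewrite addrK nmN.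
have := ler_norm M; lra.
Qed.

End Involution.
End Sphere.

(** * The graph of the covering correspondence and its point at infinity *)

Section Graph.
Variable R : realType.
Local Notation C := (Cplx R).
Local Notation Chat := (sphere R).
Implicit Types z w : C.

Definition cov_eq z w : Prop := z ^+ 2 + z * w + w ^+ 2 - 3 = 0.

Lemma cov_eq_sym z w : cov_eq z w -> cov_eq w z.
Proof. by rewrite /cov_eq => <-; ring. Qed.

(** The quadratic formula: [w^2 + z w + z^2 - 3] has discriminant [12 - 3 z^2]. *)
Lemma cov_eq_root z : exists w, cov_eq z w.
Proof.
exists ((- z + sqrtC (12 - 3 * z ^+ 2)) / 2); rewrite /cov_eq.
set s := sqrtC _; have sE : s ^+ 2 = 12 - 3 * z ^+ 2 by exact: sqrtCK.
transitivity ((3 * z ^+ 2 + s ^+ 2 - 12) / 4); first by field.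
by rewrite sE; field.
Qed.

(** The equation gives [nm w ^ 2 <= 3 + nm z * nm w + nm z ^ 2], which fails once [nm w] exceeds
    [2 Z + 3]. Hence the two coordinates can only tend to infinity together. *)
Lemma cov_eq_bounded z w (Z : R) : cov_eq z w -> 0 <= Z -> nm z <= Z ->
  nm w <= 2 * Z + 3.
Proof.
move=> e Z0 zZ; rewrite leNgt; apply/negP => wZ.
have : nm w ^+ 2 <= 3 + nm z * nm w + nm z ^+ 2.
  have <- : nm (3 - z * w - z ^+ 2) = nm w ^+ 2.
    by rewrite -nmX; congr nm; rewrite -[LHS]addr0 -e; ring.
  rewrite -nmM -nmX -(nm_nat R 3).
  apply: le_trans (ler_nmD _ _) _; rewrite nmN lerD2r.
  by apply: le_trans (ler_nmD _ _) _; rewrite nmN.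
have := nm_ge0 z; have := nm_ge0 w; nra.
Qed.

(** The equation is a closed condition on [C * C], and [fin] maps neighbourhoods to neighbourhoods,
    so the closure adds no pair of finite points. *)
Lemma graph_cov_fin z w : @graph_cov R (fin z, fin w) <-> cov_eq z w.
Proof.
split=> [cl|e]; last by apply: subset_closure; exists (z, w).
apply/eqP/negP => /negP e.
pose P (p : C * C) := p.1 ^+ 2 + p.1 * p.2 + p.2 ^+ 2 - 3.
have c1 : {for (z, w), continuous (fun p : C * C => p.1)} by exact: cvg_fst.
have c2 : {for (z, w), continuous (fun p : C * C => p.2)} by exact: cvg_snd.
have cP : {for (z, w), continuous P}.
  have H := contB (contD (contD (contX 2 c1) (contM c1 c2)) (contX 2 c2))
    (cont_cst 3 (z, w)).
  exact: H.
have : nbhs (P (z, w)) [set y | y != 0].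
  apply/nbhsCP; exists (nm (P (z, w))); first by rewrite nm_gt0.
  by move=> y; apply: contraTneq => ->; rewrite nmB subr0 ltxx.
move=> /cP[[A B] /= [zA wB] AB].
have [|q [[[z' w'] /= e' <-]]] := cl (fin (R:=R) @` A `*` fin (R:=R) @` B).
  exists (fin (R:=R) @` A, fin (R:=R) @` B) => //.
  by split; exact: nbhs_fin_image.
move=> [[z1 Az [zz]] [w1 Bw [ww]]].
by have := AB (z', w'); rewrite /= -zz -ww => /(_ (conj Az Bw));
  rewrite /P /= zz ww e' eqxx.
Qed.

Lemma nbhs_setX (T U : topologicalType) (x : T) (y : U) A B :
  nbhs x A -> nbhs y B -> nbhs (x, y) (A `*` B).
Proof. by move=> xA yB; exists (A, B). Qed.

Lemma nbhs_fin_ball z : nbhs (fin z : Chat) (@fin R @` [set w | nm (w - z) <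
  1]).
Proof. by apply: nbhs_fin_image; apply/nbhsCP; exists 1. Qed.

Lemma nbhs_infty_gt (M : R) :
  nbhs (infty R : Chat) (infty R |` @fin R @` [set w | M < nm w]).
Proof. by apply/nbhs_inftyP; split; [left|exists M => w; right; exists w]. Qed.

Lemma graph_cov_fin_infty z : ~ @graph_cov R (fin z, infty R).
Proof.
set Z := nm z + 1 => cl; have [] := cl (@fin R @` [set w | nm (w - z) < 1] `*`
  (infty R |` @fin R @` [set w | 2 * Z + 3 < nm w])).
  exact: nbhs_setX (nbhs_fin_ball _) (nbhs_infty_gt _).
move=> _ [[[z' w'] /= e <-]] [[z1 zz /fin_inj E1]] /= [//|[w1 ww /fin_inj E2]].
move: zz ww; rewrite /= {}E1 {}E2 => zz ww.
have Z0 : 0 <= Z by have := nm_ge0 z; rewrite /Z; lra.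
have : nm z' <= Z.
  by have := ler_nmD (z' - z) z; rewrite subrK /Z; move: zz => /=; lra.
move=> /(cov_eq_bounded e Z0); lra.
Qed.

Lemma graph_cov_infty_fin z : ~ @graph_cov R (infty R, fin z).
Proof.
set Z := nm z + 1 => cl;
  have [] := cl ((infty R |` @fin R @` [set w | 2 * Z + 3 < nm w]) `*`
  @fin R @` [set w | nm (w - z) < 1]).
  exact: nbhs_setX (nbhs_infty_gt _) (nbhs_fin_ball _).
move=> _ [[[w' z'] /= /cov_eq_sym e <-]] [/= [//|[w1 ww /fin_inj E2]]] [z1 zz
  /fin_inj E1].
move: zz ww; rewrite /= {}E1 {}E2 => zz ww.
have Z0 : 0 <= Z by have := nm_ge0 z; rewrite /Z; lra.
have : nm z' <= Z.
  by have := ler_nmD (z' - z) z; rewrite subrK /Z; move: zz => /=; lra.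
move=> /(cov_eq_bounded e Z0); lra.
Qed.

Lemma graph_cov_infty : @graph_cov R (infty R, infty R).
Proof.
move=> U [[A B] /= [/nbhs_inftyP[Ai [M MA]] /nbhs_inftyP[Bi [N NB]]] AB].
set Z := `|M| + `|N|; have Z0 : 0 <= Z by rewrite addr_ge0.
(* A first coordinate above [2 Z + 3] forces the second one above [Z], by the bound with exchanged
   coordinates. *)
have [n nZ] : exists n : nat, 2 * Z + 3 < n%:R.
  by exists (Num.truncn (2 * Z + 3)).+1; rewrite truncnS_gt.
have [w e] := cov_eq_root n%:R.
exists (fin n%:R, fin w); split; first by exists (n%:R, w).
apply: AB; split => /=.
  by apply: MA; rewrite nm_nat; have := ler_norm M; have := normr_ge0 M;
    have := normr_ge0 N; rewrite /Z in nZ; lra.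
apply: NB; apply: (@le_lt_trans _ _ Z).
  by have := ler_norm N; have := normr_ge0 M; rewrite /Z; lra.
rewrite ltNge; apply/negP => /(cov_eq_bounded (cov_eq_sym e) Z0).
by rewrite nm_nat; lra.
Qed.

Lemma graph_cov_sym (p q : Chat) : @graph_cov R (p, q) -> @graph_cov R (q, p).
Proof.
case: p q => [z|] [w|].
- by move=> /graph_cov_fin/cov_eq_sym e; exact: (graph_cov_fin _ _).2 e.
- by move=> /graph_cov_fin_infty.
- by move=> /graph_cov_infty_fin.
- exact.
Qed.

Lemma graph_FE (a : C) (p q : Chat) : a != 1 ->
  graph_F a (p, q) <-> @graph_cov R (p, Jinv a q).
Proof.
move=> a1; split; first by move=> [[x y] /= xy [<- <-]]; rewrite JinvK.
by move=> pq; exists (p, Jinv a q) => //=; rewrite JinvK.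
Qed.

End Graph.

(** * An attracting petal at the parabolic fixed point *)

Section Petal.
Variable R : realType.
Local Notation C := (Cplx R).
Variable a : C.
Hypothesis a1 : a != 1.

(** The translation term of the parabolic branch in the coordinate [u = 1 / (z - 1)]. It equals
    [- (a - 7) / (3 (a - 1))], so it vanishes exactly when [a = 7]. *)
Let k : C := 2 / (a - 1) - 1 / 3.

(** This is the covering equation at [z = 1 + x], [w = 1 + y]. Its roots have product [x (3 + x)]
    and sum [- (3 + x)], hence [nm y1 * nm y2 <= nm x * (nm y1 + nm y2)]; so [nm y1 > 2 nm x] forces
    [nm y2 <= 2 nm x]. *)
Lemma small_root (x : C) : nm x <= 1 -> exists y : C,
  3 * x + 3 * y + x ^+ 2 + x * y + y ^+ 2 = 0 /\ nm y <= 2 * nm x.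
Proof.
move=> x1; have [w e] := cov_eq_root (1 + x).
pose y1 := w - 1; pose y2 := - (3 + x) - y1.
have e1 : 3 * x + 3 * y1 + x ^+ 2 + x * y1 + y1 ^+ 2 = 0.
  by rewrite -e /y1; ring.
have e2 : 3 * x + 3 * y2 + x ^+ 2 + x * y2 + y2 ^+ 2 = 0.
  by rewrite -e1 /y2; ring.
have y12 : nm y1 * nm y2 = nm x * nm (3 + x).
  by rewrite -!nmM; congr nm; apply/eqP; rewrite -subr_eq0 -oppr_eq0 -e1 /y2;
    apply/eqP; ring.
have s12 : nm (3 + x) <= nm y1 + nm y2.
  have -> : 3 + x = - (y1 + y2) by rewrite /y2; ring.
  by rewrite nmN ler_nmD.
have x3 : 2 <= nm (3 + x).
  have := ler_nmD (3 + x) (- x); rewrite addrK nmN nm_nat; lra.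
have [le1|lt1] := leP (nm y1) (2 * nm x); first by exists y1.
exists y2; split=> //.
have := nm_ge0 x; have := nm_ge0 y2; nra.
Qed.

(** In the coordinate [1 / (z - 1)], [Jinv a] becomes [t |-> 2 / (a - 1) - t], and the small root
    [y] at [x = 1 / u] satisfies [1/x + 1/y = 1 / (3 + y + x)]. Comparing the last term with [1/3]
    gives the expansion of [v], with [r] near [- 1/27]. *)
Lemma parabolic_step : exists2 N : R, 0 < N &
  forall u : C, N < nm u -> exists v r : C,
    [/\ v = u + k + r / u ^+ 2, nm (r + 1 / 27) <= (nm u)^-1 &
        graph_F a (fin (1 + u^-1), fin (1 + v^-1))].
Proof.
have b0 : a - 1 != 0 by rewrite subr_eq0.
have pb : 0 < nm (a - 1) by rewrite nm_gt0.
(* The 20 makes [x] and [y] small compared with 3; the other term gives [nm (2 * y) < nm (a - 1)],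
   so that [1 + y] is not the pole of [Jinv a]. *)
exists (20 + 4 / nm (a - 1)); first by rewrite addr_gt0// divr_gt0.
move=> u uN.
have b4 : 0 < 4 / nm (a - 1) by rewrite divr_gt0.
have u20 : 20 < nm u by lra.
have u0 : u != 0 by rewrite -nm_gt0; lra.
set t := (nm u)^-1.
have t0 : 0 < t by rewrite invr_gt0; lra.
have tu : t * nm u = 1 by rewrite mulVf// nm_eq0.
have t20 : 20 * t < 1 by nra.
have tb : 4 * t < nm (a - 1).
  have : 4 / nm (a - 1) < nm u by lra.
  by rewrite ltr_pdivrMr// => h; nra.
pose x := u^-1; have xt : nm x = t by rewrite nmV.
have x0 : x != 0 by rewrite invr_eq0.
have [|y [e yx]] := @small_root x; first by rewrite xt; lra.
rewrite xt in yx.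
have ny := nm_ge0 y.
have y3s : 3 - 2 * t <= nm (3 + y).
  by have := ler_nmD (3 + y) (- y); rewrite addrK nmN nm_nat; lra.
have y3 : 2 <= nm (3 + y) by lra.
have xy3 : 2 <= nm (3 + y + x).
  by have := ler_nmD (3 + y + x) (- x); rewrite addrK nmN xt; lra.
have y3' : 3 + y != 0 by rewrite -nm_gt0; lra.
have xy3' : 3 + y + x != 0 by rewrite -nm_gt0; lra.
have y0 : y != 0.
  apply/eqP => y0; move: e; rewrite y0 !mulr0 expr0n /= !addr0 => e.
  have : x * (3 + x) = 0 by rewrite -e; ring.
  by move/eqP; rewrite mulf_eq0 (negbTE x0) /= => /eqP x3; move: xy3';
    rewrite y0 addr0 x3 eqxx.
have yb : 2 * y - (a - 1) != 0.
  rewrite subr_eq0; apply/eqP => yb.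
  have : nm (2 * y) = nm (a - 1) by rewrite yb.
  by rewrite nmM nm_nat; lra.
have e1 : x * y = (x + y) * (3 + y + x).
  by apply/eqP; rewrite -subr_eq0 -oppr_eq0 -e; apply/eqP; ring.
have e2 : - x ^+ 2 = (x + y) * (3 + y).
  by apply/eqP; rewrite -subr_eq0 -oppr_eq0 -e; apply/eqP; ring.
have xy0 : x + y != 0.
  by apply/eqP => h; move: (mulf_neq0 x0 y0); rewrite e1 h mul0r eqxx.
have i1 : x^-1 + y^-1 = (3 + y + x)^-1.
  have -> : x^-1 + y^-1 = (x + y) / (x * y) by field; rewrite x0 y0.
  by rewrite e1; field; rewrite xy0 xy3'.
pose r := - 1 / (3 * (3 + y) * (3 + y + x)).
have i2 : 1 / 3 - (3 + y + x)^-1 = r * x ^+ 2.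
  have -> : r * x ^+ 2 = - x ^+ 2 / (3 * (3 + y) * (3 + y + x)).
    by rewrite /r; field; rewrite y3' xy3'.
  by rewrite e2; field; rewrite y3' xy3'.
pose v := 2 / (a - 1) - y^-1.
have vE : v = (2 * y - (a - 1)) / ((a - 1) * y).
  by rewrite /v; field; rewrite b0 y0.
exists v, r; split.
- have -> : r / u ^+ 2 = r * x ^+ 2 by rewrite -exprVn.
  by rewrite -i2 -i1 /v /k /x invrK; ring.
- have -> : r + 1 / 27 = (6 * y + 3 * x + y ^+ 2 + y * x) / (27 * (3 + y) * (3
  + y + x)).
    by rewrite /r; field; rewrite y3' xy3'.
  rewrite nmM nmV !nmM nm_nat -/t ler_pdivrMr; last by nra.
  have AB : 4 <= nm (3 + y) * nm (3 + y + x) by nra.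
  (* The numerator is at most [15 t + 6 t^2 <= 16 t], the denominator at least [27 * 4]. *)
  apply: (@le_trans _ _ (16 * t)); last by rewrite -!mulrA; nra.
  apply: le_trans (ler_nmD _ _) _.
  apply: (@le_trans _ _ (nm (6 * y) + nm (3 * x) + nm (y ^+ 2) + nm (y * x))).
    rewrite lerD2r; apply: le_trans (ler_nmD _ _) _; rewrite lerD2r.
    exact: ler_nmD.
  by rewrite nmX !nmM !nm_nat xt; nra.
- apply/graph_FE => //; suff -> : Jinv a (fin (1 + v^-1)) = fin (1 + y).
    by apply/graph_cov_fin; rewrite /cov_eq -e -/x; ring.
  apply: (can_inj (JinvK a1)); rewrite JinvK//=.
  have E : 2 * (1 + y) - (a + 1) = 2 * y - (a - 1) by ring.
  rewrite E (negbTE yb); congr Some; rewrite vE invf_div.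
  by field; rewrite yb.
Qed.

(** The real part of [h] is a height that the branch does not decrease far out. If [k != 0], [u / k]
    grows by about 1; if [k = 0], [- u^3] grows by about [1/9], since [- 3 r] is close to [1/9].
    High superlevel sets are then non-empty, near infinity and invariant. *)
Lemma petal_height : exists2 h : C -> C, (forall x, {for x, continuous h}) &
  [/\ forall M : R, exists u, M < complex.Re (h u),
      forall N : R, exists M, forall u, M < complex.Re (h u) -> N < nm u &
      exists N : R, forall u v r, N < nm u ->
        v = u + k + r / u ^+ 2 -> nm (r + 1 / 27) <= (nm u)^-1 ->
        complex.Re (h u) <= complex.Re (h v)].
Proof.
have ReD (x y : C) : complex.Re (x + y) = complex.Re x + complex.Re y.
  by case: x y => [? ?] [? ?].
have rbound (u r : C) : 20 < nm u -> nm (r + 1 / 27) <= (nm u)^-1 -> nm r <= 1.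
  move=> u20; rewrite div1r => ru.
  have := ler_nmD (r + 27^-1) (- 27^-1); rewrite addrK nmN nmV nm_nat.
  have : (nm u)^-1 <= 20^-1 by rewrite lef_pV2 ?posrE; lra.
  lra.
have [k0|k0] := eqVneq k 0.
  exists (fun u => - u ^+ 3); first by move=> x;
    exact: (contN (contX 3 (cont_id x))).
  split.
  - move=> M; pose n := (Num.truncn M).+1.
    exists (- n%:R); rewrite exprNn -signr_odd /= expr1 mulN1r opprK -natrX.
    have -> : ((n ^ 3)%N%:R : C) = ((n ^ 3)%N%:R)%:C%C by rewrite rmorph_nat.
    rewrite /=; apply: (@lt_le_trans _ _ n%:R); first by rewrite /n truncnS_gt.
    by rewrite ler_nat -[X in (X <= _)%N]expn1 leq_pexp2l.
  - move=> N; exists (`|N| ^+ 3) => u uM; apply: le_lt_trans (ler_norm N) _.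
    rewrite -(ltr_pXn2r (n := 3)) ?nnegrE ?nm_ge0//; apply: lt_le_trans uM _.
    by rewrite -nmX -(nmN (u ^+ 3)); apply: le_trans (ler_norm _) (ler_Re_nm _).
  - exists 100 => u v r u100 -> ru; rewrite k0 addr0.
    have r1 : nm r <= 1 by apply: rbound ru; lra.
    have u0 : u != 0 by rewrite -nm_gt0; lra.
    (* The cube is expanded and [- 3 r] written as [1/9 - 3 (r + 1/27)]. With [t = 1 / nm u], the
       subtracted sum is at most [7 t < 1/9]. *)
    have -> : - (u + r / u ^+ 2) ^+ 3 = - u ^+ 3 + (1 / 9 -
        (3 * (r + 1 / 27) + 3 * r ^+ 2 / u ^+ 3 + r ^+ 3 / u ^+ 6)).
      by field.
    rewrite ReD lerDl; set s := (X in _ - X).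
    have -> : complex.Re (1 / 9 - s) = 1 / 9 - complex.Re s.
      have -> : (1 / 9 : C) = ((1 / 9)%:C)%C by rewrite rmorphM /= fmorphV /=
        rmorph_nat rmorph1.
      by case: (s).
    have : complex.Re s <= nm s by apply: le_trans (ler_norm _) (ler_Re_nm _).
    suff : nm s <= 1 / 9 by lra.
    set t := (nm u)^-1 in ru *.
    have t0 : 0 < t by rewrite invr_gt0; lra.
    have tu : t * nm u = 1 by rewrite mulVf// nm_eq0.
    have t100 : 100 * t < 1 by nra.
    have r0 := nm_ge0 r.
    have A : nm (3 * (r + 1 / 27)) <= 3 * t by rewrite nmM nm_nat; lra.
    have B : nm (3 * r ^+ 2 / u ^+ 3) <= 3 * t.
      rewrite !nmM nmV !nmX nm_nat -exprVn -/t -mulrA ler_pM2l//.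
      have : nm r ^+ 2 <= 1 by rewrite exprn_ile1.
      have : t ^+ 3 <= t by rewrite -[leRHS]expr1 ler_wiXn2l//; lra.
      have : 0 <= t ^+ 3 by rewrite exprn_ge0//; lra.
      have : 0 <= nm r ^+ 2 by rewrite exprn_ge0.
      nra.
    have D : nm (r ^+ 3 / u ^+ 6) <= t.
      rewrite !nmM nmV !nmX -exprVn -/t.
      have : nm r ^+ 3 <= 1 by rewrite exprn_ile1.
      have : t ^+ 6 <= t by rewrite -[leRHS]expr1 ler_wiXn2l//; lra.
      have : 0 <= t ^+ 6 by rewrite exprn_ge0//; lra.
      have : 0 <= nm r ^+ 3 by rewrite exprn_ge0.
      nra.
    have := ler_nmD (3 * (r + 1 / 27) + 3 * r ^+ 2 / u ^+ 3) (r ^+ 3 / u ^+ 6).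
    have := ler_nmD (3 * (r + 1 / 27)) (3 * r ^+ 2 / u ^+ 3).
    rewrite -/s; lra.
have pk : 0 < nm k by rewrite nm_gt0.
exists (fun u => u / k).
  by move=> x; exact: (contM (cont_id x) (cont_cst k^-1 x)).
split.
- move=> M; exists (k * (M + 1)%:C%C); rewrite mulrAC divff// mul1r /=; lra.
- move=> N; exists (N / nm k) => u; rewrite ltr_pdivrMr// => uM.
  apply: lt_le_trans uM _; rewrite -ler_pdivlMr// -nmV -nmM.
  by apply: le_trans (ler_norm _) (ler_Re_nm _).
(* The bounds [nm r <= 1], [nm u > 20] and [nm k * nm u > 1] keep the error [r / (u^2 k)] below
   1. *)
- exists (20 + (nm k)^-1) => u v r uN -> ru.
  have ki0 : 0 < (nm k)^-1 by rewrite invr_gt0.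
  have u20 : 20 < nm u by lra.
  have uk : (nm k)^-1 < nm u by lra.
  have r1 := rbound _ _ u20 ru.
  have u0 : u != 0 by rewrite -nm_gt0; lra.
  have -> : (u + k + r / u ^+ 2) / k = u / k + (1 + r / u ^+ 2 / k).
    by field; rewrite u0 k0.
  rewrite ReD lerDl; set s := _ / k.
  have -> : complex.Re (1 + s) = 1 + complex.Re s by rewrite ReD.
  have : `|complex.Re s| <= nm s := ler_Re_nm s.
  rewrite ler_norml => /andP[+ _].
  suff : nm s <= 1 by lra.
  rewrite /s !nmM !nmV nmX ler_pdivrMr// ler_pdivrMr ?exprn_gt0//; last by lra.
  rewrite mul1r; apply: (le_trans r1).
  move: uk; rewrite -(ltr_pM2l pk) mulfV ?gt_eqF// => uk.
  rewrite expr2; nra.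
Qed.

Lemma petal (e : R) : 0 < e -> exists D : set C,
  [/\ open D, D !=set0, (forall u, D u -> u != 0 /\ nm u^-1 < e) &
      forall u, D u -> exists2 v, D v & graph_F a (fin (1 + u^-1), fin (1 +
        v^-1))].
Proof.
move=> e0; have [N0 N00 step] := parabolic_step.
have [h ch [hinf hbig [N1 hmono]]] := petal_height.
have ei : 0 < e^-1 by rewrite invr_gt0.
(* [N0] gives access to the step, [N1] to the monotonicity of the height, and [1 / e] puts
   [1 + 1 / u] within [e] of 1. *)
pose N := Num.max (Num.max N0 N1) e^-1.
have [M hM] := hbig N.
have D3 u : M < complex.Re (h u) -> [/\ N0 < nm u, N1 < nm u & e^-1 < nm u].
  by move/hM; rewrite /N !gt_max => /andP[/andP[]].
exists [set u | M < complex.Re (h u)]; split.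
- have cRh : continuous (fun u : C => complex.Re (h u)).
    by move=> x; apply: (@continuous_comp _ _ _ h (@complex.Re R));
      [exact: ch|exact: Re_continuous].
  by apply: (@open_comp C R (fun u => complex.Re (h u)) [set x | M < x]);
    [move=> x _; exact: cRh|exact: open_gt].
- exact: hinf.
- move=> u /D3[u0 _ ue]; split; first by rewrite -nm_gt0; lra.
  by rewrite nmV -[ltRHS]invrK ltf_pV2 ?posrE//; lra.
- move=> u uM; have [u0 u1 _] := D3 _ uM.
  have [v [r [vE ru g]]] := step _ u0.
  by exists v => //=; apply: lt_le_trans uM (hmono _ _ _ u1 vE ru).
Qed.

End Petal.

(** * The boundary of the backward limit set is not a repeller *)

Section Repeller.
Variable R : realType.
Local Notation C := (Cplx R).
Local Notation Chat := (sphere R).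
Variable a : C.
Hypothesis a1 : a != 1.

Lemma image_byE (F : set (Chat * Chat)) (S : set Chat) :
  image_by (single_graph F) S = [set w | exists2 z, S z & F (z, w)].
Proof.
apply/seteqP; split=> w [z Sz].
  by move=> [p]; rewrite mem_seq1 => /eqP -> [_ /= ?]; exists z.
by move=> zw; exists z => //; exists (1%N, F) => //=; rewrite mem_seq1.
Qed.

Lemma preimage_byE (F : set (Chat * Chat)) (S : set Chat) :
  preimage_by (single_graph F) S = [set z | exists2 w, S w & F (z, w)].
Proof. by rewrite /preimage_by (image_byE [set b | F (b.2, b.1)]). Qed.

Lemma iter_preimage_subset (F : set (Chat * Chat)) (A B : set Chat) n :
  A `<=` B -> iter n (preimage_by (single_graph F)) A `<=`
              iter n (preimage_by (single_graph F)) B.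
Proof.
move=> AB; elim: n => //= n IH; rewrite !preimage_byE => z [w wA zw].
by exists w => //; exact: IH.
Qed.

Lemma subset_iter_preimage (F : set (Chat * Chat)) (A : set Chat) n :
  A `<=` preimage_by (single_graph F) A ->
  A `<=` iter n (preimage_by (single_graph F)) A.
Proof.
move=> AA; elim: n => //= n IH; apply: (subset_trans AA).
by rewrite !preimage_byE => z [w wA zw]; exists w => //; exact: IH.
Qed.

(** The preimage is the first projection of a closed subset of a compact product, hence compact. *)
Lemma closed_preimage (F : set (Chat * Chat)) (A : set Chat) :
  closed F -> closed A -> closed (preimage_by (single_graph F) A).
Proof.
move=> cF cA; rewrite preimage_byE.
have -> : [set z | exists2 w, A w & F (z, w)] = fst @` (F `&` snd @^-1` A).
  apply/seteqP; split=> [z [w Aw zw]|_ [[z w] [/= zw Aw] <-]]; last by exists w.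
  by exists (z, w).
apply: compact_closed; first exact: sphere_hausdorff.
apply: continuous_compact; first by apply: continuous_subspaceT => x;
  exact: cvg_fst.
apply: (@subclosed_compact _ _ [set: Chat * Chat]) => //.
  apply: closedI => //; apply: closed_comp => // x _; exact: cvg_snd.
by rewrite -setXTT; apply: compact_setX; exact: sphere_compact.
Qed.

Lemma graph_F_closed : closed (graph_F a).
Proof.
have -> : graph_F a = (fun p => (p.1, Jinv a p.2)) @^-1` @graph_cov R.
  by apply/seteqP; split=> -[p q] /graph_FE; apply.
apply: closed_comp; last exact: closed_closure.
move=> [x y] _ U [[A B] /= [xA yB] AB].
exists (A, Jinv a @^-1` B); first by split; [exact: xA|exact: Jinv_continuous].
by move=> [x' y'] [/= Ax By]; exact: AB.
Qed.

Lemma backward_limit_set_closed (DJ : set Chat) :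
  closed (backward_limit_set a DJ).
Proof.
apply: closed_bigI => n _; elim: n => [|n IH] /=; first exact: closed_closure.
by apply: closed_preimage => //; exact: graph_F_closed.
Qed.

Lemma graph_F_fix : graph_F a (fin 1, fin 1).
Proof.
apply/graph_FE => //; rewrite Jinv1//; apply/graph_cov_fin.
by rewrite /cov_eq; ring.
Qed.

(** The pair is [x = 1 / n] with its small root. Such pairs keep a fundamental domain of the
    covering correspondence from containing a punctured neighbourhood of 1. *)
Lemma cov_near_one (e : R) : 0 < e -> exists z w : C,
  [/\ z != 1, w != 1, nm (z - 1) < e, nm (w - 1) < e & cov_eq z w].
Proof.
move=> e0; have [n ne] : exists n : nat, 6 / e + 6 < n%:R.
  by exists (Num.truncn (6 / e + 6)).+1; rewrite truncnS_gt.
have e60 : 0 < 6 / e by rewrite divr_gt0.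
have [|y [xy yx]] := @small_root R (n%:R^-1).
  by rewrite nmV nm_nat invf_le1; lra.
set x : C := n%:R^-1 in xy yx.
have n0 : (0 : R) < n%:R by lra.
have x0 : 0 < nm x by rewrite /x nmV nm_nat invr_gt0.
have xn : nm x * n%:R = 1 by rewrite /x nmV nm_nat mulVf// gt_eqF.
have ex : 2 * nm x < e.
  have : 6 / e < n%:R by lra.
  by rewrite ltr_pdivrMr// => h; nra.
exists (1 + x), (1 + y); split.
- by rewrite -subr_eq0 addrAC subrr add0r -nm_gt0.
- rewrite -subr_eq0 addrAC subrr add0r; apply/eqP => y0.
  have : x * (3 + x) = 0 by rewrite -xy y0; ring.
  move/eqP; rewrite mulf_eq0 -nm_eq0 gt_eqF//= => /eqP x3.
  have := ler_nmD (3 + x) (- x); rewrite addrK x3 nm0 nmN nm_nat.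
  nra.
- by rewrite addrAC subrr add0r; nra.
- by rewrite addrAC subrr add0r; nra.
- by rewrite /cov_eq -xy; ring.
Qed.

Section KleinPair.
Variables Dcov DJ : set Chat.
Hypothesis kp : klein_pair a Dcov DJ.

(** If [DJ] missed a neighbourhood of 1, [Dcov] would contain all of it but 1, and with it a point
    together with one of its images. *)
Lemma closure_DJ_one : closure DJ (fin 1).
Proof.
have [[_ dcov _] _ _ _ cover] := kp.
move=> B /nbhsCP[e e0 eB]; apply: contrapT => nB.
have [z [w [z1 w1 ze we zw]]] := cov_near_one e0.
have inD (x : C) : x != 1 -> nm (x - 1) < e -> Dcov (fin x).
  move=> x1 xe; have : (Dcov `|` DJ) (fin x).
    by rewrite cover; split => // /fin_inj/eqP; rewrite (negbTE x1).
  by case=> // xJ; case: nB; exists (fin x); split => //; exact: eB.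
have : (Dcov `&` image_by (Cov R) Dcov) (fin w).
  split; first exact: inD.
  by rewrite image_byE; exists (fin z); [exact: inD|exact/graph_cov_fin].
by rewrite dcov.
Qed.

Lemma backward_limit_set_boundary :
  boundary (backward_limit_set a DJ) (fin 1).
Proof.
have [_ [oJ dJ _] _ _ _] := kp.
have JJ x : DJ x -> ~ DJ (Jinv a x).
  move=> Dx DJx; have : (DJ `&` image_by (Jcorr a) DJ) (Jinv a x).
    by split => //; rewrite image_byE; exists x.
  by rewrite dJ.
have inn n : iter n (preimage_by (F_corr a)) (closure DJ) (fin 1).
  elim: n => [|n IH]; first exact: closure_DJ_one.
  by rewrite iterS preimage_byE; exists (fin 1) => //; exact: graph_F_fix.
split; first by apply: subset_closure => n _; exact: inn.
move=> /= int1.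
have : nbhs (fin 1 : Chat) (backward_limit_set a DJ) by exact: int1.
move=> /nbhs_interior; rewrite -(Jinv1 a1).
move=> /(@Jinv_continuous R a a1 (fin 1)) /closure_DJ_one[x [DJx /= Jx]].
have cl : closure DJ (Jinv a x).
  by have /(_ 0%N Logic.I) := interior_subset Jx.
have [y [DJy]] : (DJ `&` Jinv a @^-1` DJ) !=set0.
  apply: cl; apply: (@Jinv_continuous R a a1 (Jinv a x) DJ).
  by rewrite JinvK//; exact: open_nbhs_nbhs.
exact: JJ.
Qed.

Lemma boundary_not_repeller :
  ~ repeller (F_corr a) (boundary (backward_limit_set a DJ)).
Proof.
set L := backward_limit_set a DJ.
have cL : closed L := @backward_limit_set_closed DJ.
move=> [U bU bE].
have /nbhsCP[e e0 eU] : nbhs (fin 1 : Chat) U.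
  exact: bU backward_limit_set_boundary.
have [D [oD [u0 Du0] Du Dstep]] := petal a1 e0.
pose p (u : C) : Chat := fin (1 + u^-1).
have PU : p @` D `<=` U.
  move=> _ [u /Du[_ ue] <-]; apply: eU.
  by rewrite addrAC subrr add0r.
have PF : p @` D `<=` preimage_by (F_corr a) (p @` D).
  move=> _ [u /Dstep[v Dv uv] <-]; rewrite preimage_byE.
  by exists (p v); [exists v|].
have Pb : p @` D `<=` boundary L.
  rewrite bE => z Pz K [KF [n nK]]; apply: nK.
  apply: (iter_preimage_subset PU).
  exact: subset_iter_preimage PF _ Pz.
have PL : p @` D `<=` L.
  by move=> z /Pb[]; rewrite -(closure_id _).1.
(* The petal is open and lies in the limit set, so [p u0] is interior to it and cannot be on its
   boundary. Openness comes from [q], the inverse of [p]. *)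
have [_] : boundary L (p u0) by apply: Pb; exists u0.
apply; rewrite /interior /=.
apply: (@filterS _ (nbhs (p u0)) _ (p @` D)); first exact: PL.
have [u00 _] := Du _ Du0.
pose q (z : C) := (z - 1)^-1.
have cq : {for (1 + u0^-1), continuous q}.
  apply: contV; last exact: (contB (cont_id _) (cont_cst 1 _)).
  by rewrite addrAC subrr add0r invr_eq0.
have : nbhs (1 + u0^-1) (q @^-1` D).
  by apply: cq; rewrite /q addrAC subrr add0r invrK; exact: open_nbhs_nbhs.
rewrite nbhs_finE; apply: filterS => z /= Dz; exists (q z) => //.
by rewrite /p /q invrK addrC subrK.
Qed.

End KleinPair.
End Repeller.

(** * Integration against a point mass *)

Section PointMass.
Local Open Scope ereal_scope.
Variables (R : realType) (d : measure_display) (T : measurableType d).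
Variables (mu : {measure set T -> \bar R}) (b : T) (c : R).
Hypotheses (mb : measurable [set b]) (c0 : (0 <= c)%R).
Hypothesis muE : forall A, measurable A -> mu A = (c * \1_A b)%:E.

Import HBNNSimple.

(** Of the level sets of [h], only that of the value [h b] contains [b]; the others are null. *)
Let sintegral_point_mass (h : {nnsfun T >-> R}) :
  sintegral mu h = (c * h b)%:E.
Proof.
rewrite sintegralET -(fsbig_widen [set h b])//.
  rewrite fsbig_set1 muE; last exact: measurable_sfunP.
  by rewrite indicE mem_set//= mulr1 mulrC.
move=> x [_ /= xb]; rewrite muE; last exact: measurable_sfunP.
by rewrite indicE memNset ?mulr0 ?mule0//= => hb; exact: xb.
Qed.

Let ge0_integral_point_mass (g : T -> R) : (forall x, 0 <= g x)%R ->
  \int[mu]_x (g x)%:E = (c * g b)%:E.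
Proof.
move=> g0; rewrite ge0_integralTE; last by move=> x; rewrite lee_fin.
apply/eqP; rewrite eq_le; apply/andP; split.
  apply: ge_ereal_sup => _ [h /= hg <-].
  rewrite sintegral_point_mass lee_fin ler_wpM2l//.
  by rewrite -lee_fin; exact: hg.
pose h : {nnsfun T >-> R} := scale_nnsfun (indic_nnsfun R mb) (g0 b).
have hE x : h x = (g b * \1_[set b] x)%R by [].
apply: ereal_sup_ubound; exists h.
  move=> x; rewrite lee_fin hE indicE.
  by have [/set_mem ->|_] := boolP (x \in _); rewrite ?mulr1 ?mulr0.
by rewrite sintegral_point_mass hE indicE mem_set// mulr1.
Qed.

(* [f] need not be measurable: among the simple functions below [f], the ones
   supported by the singleton [b] already reach the value. *)
Lemma integral_point_mass (f : T -> R) : \int[mu]_x (f x)%:E = (c * f b)%:E.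
Proof.
rewrite integralE -[fun x => (f x)%:E]/(EFin \o f) funerpos funerneg.
rewrite !ge0_integral_point_mass//.
rewrite -EFinB -mulrBr /funrpos /funrneg; congr (_ * _)%:E.
by rewrite /= /Order.max; case: ltP => ?; case: ltP => ?; lra.
Qed.

End PointMass.

(** * Degrees and local multiplicities under a symmetry of the graph *)

Section Conjugation.
Local Open Scope card_scope.
Variable X : topologicalType.
Variables (j : X -> X) (s : X * X -> X * X).
Hypotheses (jK : involutive j) (sK : involutive s).

(** [s] maps the fibre over [x] bijectively onto the fibre over [j x]. The set [W] localizes the
    count; the whole space gives the global one. *)
Lemma card_fibre_conj (C C' : set (X * X)) (pr pr' : X * X -> X)
    (W : set (X * X)) x n :
  (forall b, C b -> C' (s b)) -> (forall b, C' b -> C (s b)) ->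
  (forall b, pr' (s b) = j (pr b)) ->
  (C `&` W `&` pr @^-1` [set x] #= `I_n) ->
  (C' `&` s @^-1` W `&` pr' @^-1` [set j x] #= `I_n).
Proof.
move=> CC' C'C prs.
suff -> : C' `&` s @^-1` W `&` pr' @^-1` [set j x] =
    s @` (C `&` W `&` pr @^-1` [set x]).
  by apply: card_eq_trans; apply: inj_card_eq => u v _ _; exact: (can_inj sK).
apply/seteqP; split.
  move=> b [[Cb Wb] /= bx]; exists (s b); last exact: sK.
  split; first by split => //; exact: C'C.
  by apply: (can_inj jK); rewrite -prs sK.
move=> _ [b [[Cb Wb] /= bx] <-]; split; last by rewrite /= prs bx.
by split; [exact: CC'|rewrite /= sK].
Qed.

Lemma degree_conj (C C' : set (X * X)) (pr pr' : X * X -> X) :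
  (forall b, C b -> C' (s b)) -> (forall b, C' b -> C (s b)) ->
  (forall b, pr' (s b) = j (pr b)) -> degree pr C = degree pr' C'.
Proof.
move=> CC' C'C prs; have prs' b : pr (s b) = j (pr' b).
  by rewrite -[b in RHS]sK prs jK.
have half D D' p p' n : (forall b, D b -> D' (s b)) ->
    (forall b, D' b -> D (s b)) -> (forall b, p' (s b) = j (p b)) ->
    finite_set [set x | ~ (D `&` p @^-1` [set x] #= `I_n)] ->
    finite_set [set x | ~ (D' `&` p' @^-1` [set x] #= `I_n)].
  move=> DD' D'D ps /(finite_image j); apply: sub_finite_set => x /= Dx.
  exists (j x); last exact: jK.
  move=> h; apply: Dx; rewrite -[x]jK -[D']setIT.
  have := @card_fibre_conj D D' p p' setT (j x) n DD' D'D ps.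
  by rewrite setIT preimage_setT; apply.
(* The degree is not evaluated: both sides choose from the same set of integers, with the same
   default. *)
congr xget; apply/funext => n; apply/propext; split; exact: half.
Qed.

(** Since [s] fixes [b], it permutes the neighbourhoods of [b], while [j] carries punctured
    neighbourhoods of [pr b] to those of [pr' b]; the fibre counts correspond. *)
Lemma local_multiplicity_conj (C : set (X * X)) (pr pr' : X * X -> X) b :
  continuous j -> continuous s -> (forall b, C b -> C (s b)) ->
  (forall b, pr' (s b) = j (pr b)) -> s b = b ->
  local_multiplicity pr C b = local_multiplicity pr' C b.
Proof.
move=> cj cs Cs prs sb; have prs' u : pr (s u) = j (pr' u).
  by rewrite -[u in RHS]sK prs jK.
have nb W : nbhs b W -> nbhs b (s @^-1` W) by rewrite -{1}sb => /cs.
have half p p' n : (forall b, p' (s b) = j (p b)) ->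
  (exists2 W0, nbhs b W0 & forall W, nbhs b W -> W `<=` W0 ->
     \forall x \near (p b)^', C `&` W `&` p @^-1` [set x] #= `I_n) ->
  (exists2 W0, nbhs b W0 & forall W, nbhs b W -> W `<=` W0 ->
     \forall x \near (p' b)^', C `&` W `&` p' @^-1` [set x] #= `I_n).
  move=> ps [W0 bW0 h]; exists (s @^-1` W0); first exact: nb.
  move=> W bW WW0; have := h _ (nb _ bW).
  have sub : s @^-1` W `<=` W0 by move=> u /WW0; rewrite /= sK.
  move=> /(_ sub); rewrite /dnbhs /within /= => hW.
  have pb : p b = j (p' b) by rewrite -{2}sb ps jK.
  move: hW; rewrite pb => /cj hW.
  apply: (@filterS _ (nbhs (p' b)) _ _ _ _ hW) => y /= hy yb.
  have /hy : j y != j (p' b) by apply: contra yb => /eqP/(can_inj jK) ->.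
  move=> /(card_fibre_conj Cs Cs ps); rewrite jK.
  by have -> : s @^-1` (s @^-1` W) = W by apply/funext => u /=; rewrite sK.
by congr xget; apply/funext => n; apply/propext; split; exact: half.
Qed.

End Conjugation.

(** * Weak modularity through Dirac masses *)

Section WeaklyModular.
Variable R : realType.
Local Notation C := (Cplx R).
Local Notation Chat := (sphere R).
Variable a : C.
Hypothesis a1 : a != 1.

(** The covering graph is symmetric, so [Jinv a] conjugates the correspondence to its adjoint. *)
Lemma graph_F_conj (z v : Chat) :
  graph_F a (z, v) -> graph_F a (Jinv a v, Jinv a z).
Proof.
move=> /(graph_FE _ _ a1)/graph_cov_sym h.
by apply/(graph_FE _ _ a1); rewrite JinvK.
Qed.

Let b0 : Chat * Chat := (infty R, Jinv a (infty R)).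

Lemma graph_F_infty : graph_F a b0.
Proof.
by apply/(graph_FE _ _ a1); rewrite JinvK//; exact: graph_cov_infty.
Qed.

Lemma fibre_fst_infty : graph_F a `&` fst @^-1` [set infty R] = [set b0].
Proof.
apply/seteqP; split=> [[z v] [/(graph_FE _ _ a1) g /= zi]|_ ->]; last first.
  by split; first exact: graph_F_infty.
rewrite zi in g *; congr (_, _); apply: (can_inj (JinvK a1)); rewrite JinvK//.
by move: g; case: (Jinv a v) => // w /graph_cov_infty_fin.
Qed.

Lemma fibre_snd_infty :
  graph_F a `&` snd @^-1` [set Jinv a (infty R)] = [set b0].
Proof.
apply/seteqP; split=> [[z v] [/(graph_FE _ _ a1) g vi]|_ ->]; last first.
  by split; first exact: graph_F_infty.
have {}vi : v = Jinv a (infty R) := vi.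
move: g; rewrite {}vi JinvK// => g; congr (_, _).
by move: g; case: z => // w /graph_cov_fin_infty.
Qed.

Lemma topological_degree_adjoint :
  topological_degree (F_corr a) = topological_degree (adjoint (F_corr a)).
Proof.
rewrite /topological_degree /adjoint /= !big_seq1 /=; congr muln.
(* The adjoint already swaps the coordinates, so here the symmetry acts on each coordinate
   separately. *)
apply: (@degree_conj Chat (Jinv a) (fun b => (Jinv a b.1, Jinv a b.2))) => //.
- exact: JinvK.
- by move=> [z v]; rewrite /= !JinvK.
- by move=> [z v] /= /graph_F_conj.
- by move=> [z v] /= /graph_F_conj.
Qed.

Let sigma (b : Chat * Chat) : Chat * Chat := (Jinv a b.2, Jinv a b.1).

Let sigma_continuous : continuous sigma.
Proof.
move=> [z v] U [[A B] /= [zA vB] AB].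
exists (Jinv a @^-1` B, Jinv a @^-1` A).
  by split; [exact: (Jinv_continuous a1 vB)|exact: (Jinv_continuous a1 zA)].
by move=> [z' v'] [/= ? ?]; exact: AB.
Qed.

Lemma local_multiplicity_infty :
  local_multiplicity fst (graph_F a) b0 = local_multiplicity snd (graph_F a) b0.
Proof.
apply: (@local_multiplicity_conj Chat (Jinv a) sigma).
- exact: JinvK.
- by move=> [z v]; rewrite /sigma /= !JinvK.
- exact: Jinv_continuous.
- exact: sigma_continuous.
- by move=> [z v] /graph_F_conj.
- by [].
- by rewrite -[LHS]/(Jinv a (Jinv a (infty R)), Jinv a (infty R)) JinvK.
Qed.

Lemma measurable_borel_closed (T : ptopologicalType) (A : set T) :
  closed A -> measurable (A : set (borel T)).
Proof.
move=> cA; rewrite -[X in measurable X]setCK; apply: measurableC.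
by apply: sub_sigma_algebra; exact: closed_openC.
Qed.

Lemma closed_sphere_set1 (x : Chat) : closed [set x].
Proof.
apply: compact_closed; [exact: sphere_hausdorff|exact: compact_set1].
Qed.

Lemma F_corr_weakly_modular : weakly_modular R (F_corr a).
Proof.
split; first exact: topological_degree_adjoint.
pose k := local_multiplicity fst (graph_F a) b0.
have k0 : 0 <= (k%:R : R) by [].
have mass (x : Chat) (f : Chat -> R) :
    (\int[@dirac _ (borel Chat) x R]_y (f y)%:E = (f x)%:E)%E.
  rewrite (@integral_point_mass R _ (borel Chat) _ x 1) ?mul1r//.
    by apply: measurable_borel_closed; exact: closed_sphere_set1.
  by move=> A mA; rewrite [RHS]/= mul1r.
have mb0 : measurable ([set b0] : set (borel (Chat * Chat)%type)).
  apply: measurable_borel_closed.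
  have -> : [set b0] = fst @^-1` [set b0.1] `&` snd @^-1` [set b0.2].
    by apply/seteqP; split=> [_ ->//|[x y] [/= -> ->]].
  apply: closedI; apply: closed_comp => [x _|].
  - exact: cvg_fst.
  - exact: closed_sphere_set1.
  - exact: cvg_snd.
  - exact: closed_sphere_set1.
exists (@dirac _ (borel Chat) (infty R) R).
exists (@dirac _ (borel Chat) (Jinv a (infty R)) R).
(* Both fibres reduce to [b0], so each pull-back is its multiplicity at [b0] times the Dirac mass
   there; the two multiplicities agree. *)
exists (mscale (NngNum k0) (@dirac _ (borel (Chat * Chat)%type) b0 R)).
have mE (phi : Chat * Chat -> R) :
  (\int[mscale (NngNum k0) (@dirac _ (borel (Chat * Chat)%type) b0 R)]_b (phi
    b)%:E
     = (k%:R * phi b0)%:E)%E.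
  by rewrite (@integral_point_mass R _ (borel (Chat * Chat)%type) _ b0 k%:R).
split=> phi _; rewrite mE /F_corr /single_graph big_seq1 /= mul1e mass.
- by rewrite fibre_fst_infty fsbig_set1.
- by rewrite fibre_snd_infty fsbig_set1 -local_multiplicity_infty.
Qed.

End WeaklyModular.

(** * A discrete torsion-free subgroup against a compact one *)

Section DiscreteSubgroup.
Variable G : groupTopologyType.
Hypothesis mul_continuous : continuous (fun p : G * G => (p.1 * p.2)%g).
Hypothesis inv_continuous : continuous (fun x : G => (x^-1)%g).
Hypothesis hG : hausdorff_space G.

Lemma continuous_mulg (T : topologicalType) (f h : T -> G) (x : T) :
  {for x, continuous f} -> {for x, continuous h} ->
  {for x, continuous (fun y => (f y * h y)%g)}.
Proof.
move=> cf ch; have := @continuous2_cvg _ _ _ _ (nbhs x) _ f h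
  (fun u v => (u * v)%g) _ _ (@mul_continuous (f x, h x)) cf ch.
by apply; exact: nbhs_filter.
Qed.

Lemma continuous_invg (T : topologicalType) (f : T -> G) (x : T) :
  {for x, continuous f} -> {for x, continuous (fun y => (f y)^-1%g)}.
Proof. by move=> cf U /= /inv_continuous /cf. Qed.

Lemma nbhs_divg (x : G) (U : set G) : nbhs (1%g : G) U ->
  exists2 V, nbhs x V & forall u v, V u -> V v -> U (u^-1 * v)%g.
Proof.
move=> U1.
have c : {for (x, x), continuous (fun p : G * G => (p.1^-1 * p.2)%g)}.
  by apply: continuous_mulg; [apply: continuous_invg;
    exact: cvg_fst|exact: cvg_snd].
have [|[A B] /= [xA xB] AB] := c U; first by rewrite /= mulVg.
exists (A `&` B); first exact: filterI.
by move=> u v [Au _] [_ Bv]; exact: (AB (u, v)).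
Qed.

Variable L : set G.
Hypotheses (sL : subgroup L) (dL : L `<=` isolated L).

Lemma discrete_nbhs_one : exists2 U, nbhs (1%g : G) U & forall x, L x -> U x ->
  x = 1%g.
Proof.
have [L1 _ _] := sL; have [_ [U U1 UL]] := dL L1.
by exists U => // x Lx Ux; have : (U `&` L) x by []; rewrite UL.
Qed.

Lemma subgroup_divg x y : L x -> L y -> L (x^-1 * y)%g.
Proof. by have [_ LM LV] := sL => Lx Ly; apply: LM => //; exact: LV. Qed.

(** Near an adherent point [p], two elements of [L] have quotient 1 and coincide; if [p] were not
    that single element, removing it would leave none. The identity is left out so that the
    complement is also a neighbourhood of it. *)
Lemma discrete_subgroup_closed : closed (L `\ 1%g).
Proof.
have [U U1 UL] := discrete_nbhs_one.
move=> p clp; have [V pV VU] := nbhs_divg p U1.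
have same u v : L u -> L v -> V u -> V v -> u = v.
  move=> Lu Lv Vu Vv; have := UL _ (subgroup_divg Lu Lv) (VU _ _ Vu Vv).
  by move=> e; rewrite -[v]mul1g -(mulgV u) -mulgA e mulg1.
have [u [[Lu u1] Vu]] := clp _ pV.
have [->//|/eqP pu] := eqVneq p u.
have nu : nbhs p (V `&` ~` [set u]).
  apply: filterI => //; apply: open_nbhs_nbhs; split=> //.
  apply: closed_openC; apply: compact_closed => //; exact: compact_set1.
have [v [[Lv _] [Vv vu]]] := clp _ nu.
by case: vu; exact: same.
Qed.

Hypothesis tL : torsion_free L.

(** The powers of [x] have a cluster point, near which two of them with exponents [n < m] have
    quotient 1; torsion-freeness then applies to [x ^+ (m - n)]. *)
Lemma compact_powers_one (N : set G) x : compact N -> L x ->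
  (forall n, N (x ^+ n)%g) -> x = 1%g.
Proof.
move=> cN Lx Nx; have [U U1 UL] := discrete_nbhs_one.
have Lxn n : L (x ^+ n)%g.
  have [L1 LM _] := sL; elim: n => [|n IH]; first by rewrite expg0.
  by rewrite expgS; exact: LM.
have [] := cN ((fun n => (x ^+ n)%g) @ \oo) _ _.
  by exists 0%N => // n _; exact: Nx.
move=> y [_ cly]; have [V yV VU] := nbhs_divg y U1.
have [|z [[n _ <-] Vn]] := cly [set (x ^+ n)%g | n in [set: nat]] V _ yV.
  by exists 0%N => // n _; exists n.
have [|z' [[m /= nm <-] Vm]] := cly [set (x ^+ m)%g | m in [set m | (n < m)%N]]
  V _ yV.
  by exists n.+1 => // m /= nm; exists m.
apply: (tL Lx (n := (m - n)%N)); first by rewrite subn_gt0.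
apply: UL; first exact: Lxn.
have := VU _ _ Vn Vm.
suff -> : ((x ^+ n)^-1 * x ^+ m)%g = (x ^+ (m - n))%g by [].
by rewrite -[in LHS](subnKC (ltnW nm)) expgnDr mulgA mulVg mul1g.
Qed.

Variable K : set G.
Hypotheses (cK : compact K) (sK : subgroup K).

(** From [y = l x k] one gets [l = y k^-1 x^-1], continuous in [(x, y, k)]. At [x = y = x0] the
    powers of this element stay in the compact [x0 K x0^-1], so it is not in [L] unless it is 1.
    Compactness of [K] makes the neighbourhood uniform in [k]. *)
Lemma separating_nbhs (x0 : G) : exists2 V, nbhs x0 V &
  forall x y l k, V x -> V y -> L l -> K k -> y = (l * x * k)%g -> l = 1%g.
Proof.
pose Phi (p : (G * G) * G) := (p.1.2 * p.2^-1 * p.1.1^-1)%g.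
have cPhi : continuous Phi.
  move=> p; pose GGG := ((G * G) * G)%type.
  have c11 : {for p, continuous (fun q : GGG => q.1.1)}.
    by apply: (@continuous_comp _ _ _ fst fst); exact: cvg_fst.
  have c12 : {for p, continuous (fun q : GGG => q.1.2)}.
    by apply: (@continuous_comp _ _ _ fst snd); [exact: cvg_fst|exact: cvg_snd].
  have c2 : {for p, continuous (fun q : GGG => q.2)} by exact: cvg_snd.
  exact: (continuous_mulg (continuous_mulg c12 (continuous_invg c2))
                          (continuous_invg c11)).
have Kx k : K k -> ~ (L `\ 1%g) (x0 * k^-1 * x0^-1)%g.
  move=> Kk [Lk]; apply.
  apply: (@compact_powers_one ((fun u => x0 * u * x0^-1)%g @` K)).
  - apply: continuous_compact => //; apply: continuous_subspaceT => u.
    have ccst c : {for u, continuous (fun _ : G => c : G)} by exact: cvg_cst.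
    have cid : {for u, continuous (fun v : G => v)} by exact: cvg_id.
    exact: (continuous_mulg (continuous_mulg (ccst x0) cid) (ccst x0^-1%g)).
  - exact: Lk.
  - move=> n; have [K1 KM KV] := sK; elim: n => [|n [u Ku uE]].
      by exists 1%g => //; rewrite mulg1 mulgV expg0.
    exists (k^-1 * u)%g; first by apply: KM => //; exact: KV.
    by rewrite expgS -uE !mulgA mulgVK.
have /compact_near_coveringP ncK := cK.
have := ncK _ (nbhs (x0, x0)) (fun p k => ~ (L `\ 1%g) (Phi (p, k))) _ _.
case.
  move=> k Kk.
  have : nbhs (Phi ((x0, x0), k)) (~` (L `\ 1%g)).
    by apply: open_nbhs_nbhs; split; [apply: closed_openC;
      exact: discrete_subgroup_closed|exact: Kx].
  move=> /cPhi[[A B] /= [xA kB] AB].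
  by exists (B, A) => // -[k' p] /= [Bk Ap]; exact: (AB (p, k')).
move=> [A B] /= [xA xB] AB; exists (A `&` B); first exact: filterI.
move=> x y l k [Ax _] [_ By] Ll Kk yE; apply: contrapT => l1.
apply: (AB (x, y) (conj Ax By) k Kk); rewrite /Phi /= yE.
by rewrite mulgK mulgK; split.
Qed.

End DiscreteSubgroup.

(** * Local selections of modular correspondences *)

Section DoubleCosets.
Variable G : groupTopologyType.
Hypothesis mul_continuous : continuous (fun p : G * G => (p.1 * p.2)%g).
Hypothesis inv_continuous : continuous (fun x : G => (x^-1)%g).
Hypothesis hG : hausdorff_space G.
Variables L K : set G.
Hypotheses (sL : subgroup L) (sK : subgroup K).

Lemma to_double_cosetP (x y : G) :
  to_double_coset L K x = to_double_coset L K y <->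
  exists l k, [/\ L l, K k & y = (l * x * k)%g].
Proof.
have [L1 LM LV] := sL; have [K1 KM KV] := sK.
split.
  move=> /eqmodP /asboolP e.
  have : double_coset L K y y by exists 1%g => //; exists 1%g => //;
    rewrite mul1g mulg1.
  by rewrite -e => -[l Ll [k Kk ->]]; exists l, k.
move=> [l [k [Ll Kk ->]]]; apply/eqmodP/asboolP; apply/seteqP; split.
  move=> _ [l' Ll' [k' Kk' ->]]; exists (l' * l^-1)%g;
    first by apply: LM => //; exact: LV.
  exists (k^-1 * k')%g; first by apply: KM => //; exact: KV.
  by rewrite !mulgA mulgVK mulgK.
move=> _ [l' Ll' [k' Kk' ->]]; exists (l' * l)%g; first exact: LM.
by exists (k * k')%g; [exact: KM|rewrite !mulgA].
Qed.

Lemma to_double_coset_continuous : continuous (to_double_coset L K).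
Proof. exact: pi_continuous. Qed.

(** The saturation of [V] is the union of the open translates [l^-1 V k^-1]. *)
Lemma to_double_coset_open (V : set G) : open V ->
  open (to_double_coset L K @` V).
Proof.
move=> oV; have [L1 LM LV] := sL; have [K1 KM KV] := sK.
suff oE : open (to_double_coset L K @^-1` (to_double_coset L K @` V)) by exact:
  oE.
have -> : to_double_coset L K @^-1` (to_double_coset L K @` V) =
    \bigcup_(p in L `*` K) [set y | V (p.1 * y * p.2)%g].
  apply/seteqP; split=> y.
    move=> [x Vx /esym/to_double_cosetP[l [k [Ll Kk xE]]]].
    by exists (l, k); [split|rewrite /= -xE].
  move=> [[l k] [/= Ll Kk] Vy]; exists (l * y * k)%g => //.
  by apply/esym/to_double_cosetP; exists l, k.
apply: bigcup_open => -[l k] _.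
have c : continuous (fun y : G => (l * y * k)%g).
  move=> u.
  have ccst c : {for u, continuous (fun _ : G => c : G)} by exact: cvg_cst.
  have cid : {for u, continuous (fun v : G => v)} by exact: cvg_id.
  exact: (continuous_mulg mul_continuous (continuous_mulg mul_continuous (ccst
    l) cid) (ccst k)).
by apply: (@open_comp _ _ (fun y : G => (l * y * k)%g) V) => // x _; exact: c.
Qed.

Hypotheses (dL : L `<=` isolated L) (tL : torsion_free L) (cK : compact K).
Variables (Y : ptopologicalType) (f : double_coset_space L K -> Y).
Hypothesis hf : homeomorphism f.

(* Near [x0] the fibres of [G -> L \ G / K] are the cosets [x K], which left
   multiplication by [g] permutes. *)
Lemma modular_graph_selection (g : G) (y0 : Y) : exists2 B : set Y, nbhs y0 B &
  exists s : Y -> Y, forall y, B y ->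
    [set (f b.1, f b.2) | b in modular_graph L K g] (y, s y) /\
    {for y, continuous s}.
Proof.
have [cf [f' [cf' fK f'K]]] := hf.
have [_ KM KV] := sK.
pose P x := f (to_double_coset L K x).
have cP : continuous P.
  by move=> x; apply: (@continuous_comp _ _ _ (to_double_coset L K) f);
    [exact: to_double_coset_continuous|exact: cf].
have cPg : continuous (fun x => P (g * x)%g).
  move=> x; apply: (@continuous_comp _ _ _ (fun x => (g * x)%g) P);
    last exact: cP.
  have ccst : {for x, continuous (fun _ : G => g : G)} by exact: cvg_cst.
  have cid : {for x, continuous (fun v : G => v)} by exact: cvg_id.
  exact: (continuous_mulg mul_continuous ccst cid).
have oP V : open V -> open (P @` V).
  move=> oV; have -> : P @` V = f' @^-1` (to_double_coset L K @` V).
    apply/seteqP; split=> [_ [x Vx <-]|y /= [x Vx xy]]; first by exists x;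
      rewrite // fK.
    by exists x => //; rewrite /P xy f'K.
  by apply: open_comp; [move=> y _; exact: cf'|exact: to_double_coset_open].
have [x0 x0E] : exists x, P x = y0.
  by exists (repr (f' y0)); rewrite /P /to_double_coset reprK f'K.
have [V x0V Vsep] := separating_nbhs mul_continuous inv_continuous hG sL dL tL
  cK sK x0.
have fibre x y : V x -> V y -> P x = P y -> P (g * x)%g = P (g * y)%g.
  move=> Vx Vy /(can_inj fK)/to_double_cosetP[l [k [Ll Kk yE]]].
  have l1 := Vsep _ _ _ _ Vx Vy Ll Kk yE.
  congr f; apply/to_double_cosetP; exists 1%g, k; split => //;
    first by have [] := sL.
  by rewrite yE l1 !mul1g mulgA.
(* A lift of [y] to [V] is chosen; by [fibre] the value does not depend on it. The default is used
   only off the image of [V]. *)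
pose s y := P (g * xget 1%g [set x | V x /\ P x = y])%g.
have sE x : V x -> s (P x) = P (g * x)%g.
  move=> Vx; rewrite /s; have [] : [set x' | V x' /\ P x' = P x]
      (xget 1%g [set x' | V x' /\ P x' = P x]).
    by apply: (@xgetI _ 1%g _ x).
  by move=> Vx' Px'; exact: fibre.
exists (P @` V°).
  apply: open_nbhs_nbhs; split; first by apply: oP; exact: open_interior.
  by exists x0.
exists s => _ [x Vx <-]; have Vx' := interior_subset Vx; split.
  rewrite sE//; exists (to_double_coset L K x, to_double_coset L K (g * x)%g)
    => //.
  by exists x.
move=> W; rewrite sE// => /cPg xW.
(* Since [P] is open, it sends the interior of this set to a neighbourhood of [P x], on which [s]
   takes values in [W]. *)
have /nbhs_interior xVW : nbhs x (V `&` (fun x => P (g * x)%g) @^-1` W).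
  by apply: filterI => //; exact: xW.
apply: (@filterS _ (nbhs (P x)) _
  (P @` (V `&` (fun x => P (g * x)%g) @^-1` W)°)).
  by move=> _ [x' /interior_subset[Vx1 Wx1] <-] /=; rewrite sE.
apply: open_nbhs_nbhs; split; first by apply: oP; exact: open_interior.
by exists x => //; exact: nbhs_singleton.
Qed.

End DoubleCosets.

(** * The branch point 2 and the failure of modularity *)

Section NotModular.
Variable R : realType.
Local Notation C := (Cplx R).
Local Notation Chat := (sphere R).

(* [z = 2 (1 - m^2) / (1 + m^2)] turns [12 - 3 z^2] into
   [48 m^2 / (1 + m^2)^2], so [h] would give a continuous choice of sign of
   [sqrt 48] that is odd in [m]. *)
Lemma no_continuous_sqrt (h : C -> C) (e : R) : 0 < e ->
  ~ (forall z : C, nm (z - 2) < e ->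
       {for z, continuous h} /\ h z ^+ 2 = 12 - 3 * z ^+ 2).
Proof.
move=> e0 hh.
pose zz (m : C) := 2 * (1 - m ^+ 2) / (1 + m ^+ 2).
pose c m := h (zz m) * (1 + m ^+ 2) / m.
(* For [nm m <= r], [1 + m^2] has modulus at least [15/16], and [zz m - 2 = - 4 m^2 / (1 + m^2)] is
   smaller than [e]. *)
pose r := Num.min (1 / 4) (e / 2).
have r0 : 0 < r by rewrite lt_min !divr_gt0.
have [r4 re] : r <= 1 / 4 /\ r <= e / 2 by rewrite /r !ge_min !lexx orbT.
have small (m : C) : nm m <= r -> 1 + m ^+ 2 != 0 /\ nm (zz m - 2) < e.
  move=> mr; have m0 := nm_ge0 m.
  have d : 15 / 16 <= nm (1 + m ^+ 2).
    by have := ler_nmD (1 + m ^+ 2) (- m ^+ 2);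
      rewrite addrK nmN nmX (nm_nat R 1); nra.
  have d0 : 1 + m ^+ 2 != 0 by rewrite -nm_gt0; lra.
  split=> //; have -> : zz m - 2 = - 4 * m ^+ 2 / (1 + m ^+ 2) by rewrite /zz;
    field.
  rewrite nmM nmV nmM nmN nm_nat nmX ltr_pdivrMr; last by lra.
  nra.
have c2 m : m != 0 -> nm m <= r -> c m ^+ 2 = 48.
  move=> m0 /small[d0 /hh[_ hE]].
  rewrite /c expr_div_n exprMn hE /zz.
  by field; rewrite m0 d0.
have cN m : c (- m) = - c m by rewrite /c /zz sqrrN invrN mulrN.
have cc m : m != 0 -> nm m <= r -> {for m, continuous c}.
  move=> m0 /small[d0 /hh[ch _]].
  have cm := cont_id m.
  have c1 := contD (cont_cst (1 : C) m) (contX 2 cm).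
  have czz : {for m, continuous zz}.
    exact: (contM (contM (cont_cst (2 : C) m) (contB (cont_cst (1 : C) m)
      (contX 2 cm)))
      (@contV R C (fun m => 1 + m ^+ 2) m d0 c1)).
  have chz : {for m, continuous (fun m => h (zz m))}.
    exact: (@continuous_comp _ _ _ zz h m czz ch).
  exact: (contM (contM chz c1) (@contV R C (fun m => m) m m0 cm)).
(* An arc from [- r] to [r] in the disc of radius [r], avoiding 0. As [c] is odd, its real part has
   opposite values at the ends and vanishes in between; there [c^2] is real and at most 0, against
   48. *)
pose p (t : R) : C := ((r * t) +i* (r * (1 - t ^+ 2)))%C.
have cp : continuous p.
  move=> t; apply: (@continuous_comp _ _ _ (fun t : R => (r * t, r * (1 - t ^+
    2)))
    (fun q : R * R => (q.1 +i* q.2)%C : C)); last exact: complexRI_continuous.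
  have cr (b : R) : {for t, continuous (fun _ : R => b)} by exact: cvg_cst.
  have cX : {for t, continuous (fun u : R => u ^+ 2)} by exact:
    exprn_continuous.
  have cid : {for t, continuous (fun u : R => u)} by exact: cvg_id.
  have c1 : {for t, continuous (fun u : R => r * u)}.
    exact: (@continuousM R R _ _ _ (cr r) cid).
  have c2' : {for t, continuous (fun u : R => r * (1 - u ^+ 2))}.
    exact: (@continuousM R R _ _ _ (cr r) (@continuousB R R R _ _ _ (cr 1) cX)).
  exact: (cvg_pair c1 c2').
have p0 t : p t != 0.
  apply/eqP => -[/eqP + /eqP]; rewrite !mulf_eq0 gt_eqF//= => /eqP ->.
  by rewrite expr0n subr0 oner_eq0.
have pr t : t \in `[-1, 1] -> nm (p t) <= r.
  rewrite in_itv /= => /andP[t1 t2].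
  rewrite -(ler_pXn2r (n := 2)) ?nnegrE ?nm_ge0 ?(ltW r0)// nm_sqr /=.
  have : t ^+ 2 <= 1 by nra.
  have := sqr_ge0 t; nra.
have [|||t t1 ft] := @IVT R (fun t => complex.Re (c (p t))) (-1) 1 0.
- lra.
- apply: continuous_in_subspaceT => t /set_mem t1.
  apply: (@continuous_comp _ _ _ (fun t => c (p t)) (@complex.Re R));
    last exact: Re_continuous.
  apply: (@continuous_comp _ _ _ p c); first exact: cp.
  by apply: cc => //; exact: pr.
- have -> : p (-1) = - p 1.
    by rewrite /p sqrrN expr1n subrr mulr0 mulrN1 -[RHS]/((- (r * 1)) +i* (-
      0))%C oppr0 mulr1.
  have -> : complex.Re (c (- p 1)) = - complex.Re (c (p 1)) by rewrite cN;
    case: (c _).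
  by rewrite ge_min le_max !oppr_le0 !oppr_ge0; case: ltgtP.
have := c2 _ (p0 t) (pr _ t1).
case: (c (p t)) ft => x y /= ->; rewrite expr2.
have -> : (48 : C) = (48%:R)%:C%C by rewrite rmorph_nat.
by move=> -[+ _]; have := sqr_ge0 y; rewrite expr2; lra.
Qed.

Variable a : C.
Hypothesis a1 : a != 1.

(** A continuous solution [w] of the covering equation near 2 would make [2 w + z] a continuous
    square root of the discriminant [12 - 3 z^2] near its simple zero 2. *)
Lemma no_continuous_selection (B : set Chat) (s : Chat -> Chat) :
  nbhs (fin 2 : Chat) B ->
  ~ (forall y, B y -> graph_F a (y, s y) /\ {for y, continuous s}).
Proof.
move=> /nbhsCP[e e0 eB] hs.
pose t (z : C) := Jinv a (s (fin z)).
pose w (z : C) : C := if t z is Some w then w else 0.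
have tE z : nm (z - 2) < e -> t z = fin (w z) /\ cov_eq z (w z).
  move=> /eB/hs[/(graph_FE _ _ a1) + _]; rewrite -/(t z) /w.
  by case: (t z) => [w'|] => [/graph_cov_fin//|/graph_cov_fin_infty].
apply: (@no_continuous_sqrt (fun z => 2 * w z + z) e e0) => z ze.
have [tz cov] := tE z ze; split; last first.
  transitivity (4 * (z ^+ 2 + z * w z + w z ^+ 2 - 3) + 12 - 3 * z ^+ 2);
    first by ring.
  by rewrite cov; ring.
have ct : {for z, continuous t}.
  apply: (@continuous_comp _ _ _ (fun z : C => s (fin z)) (Jinv a));
    last exact: Jinv_continuous.
  apply: (@continuous_comp _ _ _ (@fin R) s); first exact: fin_continuous.
  by have [] := hs _ (eB _ ze).
have cw : {for z, continuous w}.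
  move=> U wU; have : nbhs (t z) (@fin R @` U) by rewrite tz;
    exact: nbhs_fin_image.
  move=> /ct ctU; apply: (@filterS _ (nbhs z) _ (t @^-1` (@fin R @` U)));
    last exact: ctU.
  by move=> z' [u Uu tz']; rewrite /= /w -tz'.
exact: (contD (contM (cont_cst (2 : C) z) cw) (cont_id z)).
Qed.

Lemma F_corr_not_modular : ~ modular R (F_corr a).
Proof.
move=> [G [n [A [L [K [f [s [[lieG _] [[sL dL _] tL] [cK [sK _]] hf [_
  mult]]]]]]]]].
(* [graph_F a] has multiplicity 1 in [F_corr a]; if no curve of [s] were equal to it, the other
   multiplicity would be an empty sum. *)
have [p ps pE] : exists2 p, p \in s &
    [set (f b.1, f b.2) | b in modular_graph L K p.2] = graph_F a.
  apply: contrapT => np; have := mult (graph_F a).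
  rewrite /multiplicity /F_corr /single_graph big_cons big_nil /= asboolT//.
  rewrite big_map big1_seq// => p /andP[/asboolP pE ps].
  by case: np; exists p.
have hG := manifold_hausdorff (lie_manifold lieG).
have [B nB [sel hsel]] := modular_graph_selection (lie_mul lieG).1 (lie_inv
  lieG).1
  hG sL sK dL tL cK hf p.2 (fin 2).
by apply: (@no_continuous_selection B sel nB) => y /hsel[]; rewrite pE.
Qed.

End NotModular.

Theorem theorem1p1 (R : realType) (a : Cplx R) (Ka : klein_locus a) :
  (weakly_modular R (F_corr a) /\ ~ modular R (F_corr a)) /\
  (forall Dcov DJ : set (sphere R), adapted_klein_pair a Dcov DJ ->
     ~ repeller (F_corr a) (boundary (backward_limit_set a DJ))).
Proof.
have a1 : a != 1 by case: Ka.
split; first by split; [exact: F_corr_weakly_modular|exact: F_corr_not_modular].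
by move=> Dcov DJ [kp _]; exact: boundary_not_repeller kp.
Qed.
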